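(* Let $Q(x,y)\in\mathbb{C}[x^{\pm1},y^{\pm1}]$ be a Laurent polynomial with no constant term, and for $r\in\mathbb{C}$ put $Q_r(x,y)=r-Q(x,y)$. Let $a,b>0$. Let $\mathcal{R}_{a,b}=\{Q(x,y):|x|=a,\ |y|=b\}\subset\mathbb{C}$, and let $U_{a,b}$ be the unbounded open connected component of $\mathbb{C}\setminus\mathcal{R}_{a,b}$ (the one containing a neighbourhood of $\infty$); similarly $\mathcal{R}_{1,1}$, $U_{1,1}$ for $a=b=1$. For $r\in\mathbb{C}$ define $\nu^1_{a,b,r}=Z^1_{a,b,r}-P^1_{a,b,r}$, where $Z^1_{a,b,r}$ is the number of zeros (counted with multiplicity) of the Laurent polynomial $x\mapsto Q_r(x,b)$ in the punctured disc $0<|x|<a$ and $P^1_{a,b,r}$ is the order of the pole of $Q_r(x,b)$ at $x=0$; and $\nu^2_{a,b,r}=Z^2_{a,b,r}-P^2_{a,b,r}$, where $Z^2_{a,b,r}$ is the number of zeros (with multiplicity) of $y\mapsto Q_r(a,y)$ in $0<|y|<b$ and $P^2_{a,b,r}$ is the order of the pole of $Q_r(a,y)$ at $y=0$. Then for every $r\in U_{a,b}\cap U_{1,1}$, $$\mathrm{m}_{a,b}(Q_r)=\mathrm{m}(Q_r)+\nu^1_{a,b,r}\log a+\nu^2_{a,b,r}\log b .$$ Moreover, for $r\in U_{a,b}\cap U_{1,1}$ the integers $\nu^1_{a,b,r}$ and $\nu^2_{a,b,r}$ do not depend on $r$ (they depend only on $(a,b)$).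
   Context: For a nonzero rational function $P\in\mathbb{C}(x_1,\dots,x_n)$ and $\mathfrak{a}=(a_1,\dots,a_n)\in\mathbb{R}_{>0}^n$, the generalized Mahler measure is $\mathrm{m}_{\mathfrak{a}}(P)=\frac{1}{(2\pi i)^n}\int_{\mathbb{T}^n_{\mathfrak{a}}}\log|P(x_1,\dots,x_n)|\frac{dx_1}{x_1}\cdots\frac{dx_n}{x_n}$, where $\mathbb{T}^n_{\mathfrak{a}}=\{(x_1,\dots,x_n)\in(\mathbb{C}^* )^n:|x_j|=a_j\text{ for all }j\}$. The standard Mahler measure is $\mathrm{m}(P)=\mathrm{m}_{1,\dots,1}(P)$. In particular $\mathrm{m}_{a,b}(Q_r)$ is the integral over $|x|=a,|y|=b$. *)

(* Defs.v *)
From HB Require Import structures.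
From mathcomp Require Import all_boot all_order all_algebra finmap.
From mathcomp Require Import complex.
From mathcomp Require Import all_classical all_reals all_analysis.

Set Implicit Arguments.
Unset Strict Implicit.
Unset Printing Implicit Defensive.

Import Order.TTheory GRing.Theory Num.Theory.
Import numFieldNormedType.Exports.

Local Open Scope classical_set_scope.
Local Open Scope ring_scope.
Local Open Scope complex_scope.

Section Laurent.
Variable R : realType.
Local Notation C := R[i].

(* A Laurent polynomial is the family of its coefficients, indexed by exponents. *)
Definition laurent1 := {fsfun int -> C with 0}.
Definition laurent2 := {fsfun int * int -> C with 0}.

Definition eval2 (P : laurent2) (x y : C) : C :=
  \sum_(k <- finsupp P) P k * x ^ k.1 * y ^ k.2.

Definition const_sub (r : C) (Q : laurent2) : laurent2 :=
  [fsfun k in ((0, 0) |` finsupp Q)%fset => (if k == (0, 0) then r else 0) - Q k].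

Definition slice1 (P : laurent2) (y0 : C) : laurent1 :=
  [fsfun i in [fset k.1 | k in finsupp P]%fset =>
     \sum_(k <- finsupp P | k.1 == i) P k * y0 ^ k.2].

Definition slice2 (P : laurent2) (x0 : C) : laurent1 :=
  [fsfun j in [fset k.2 | k in finsupp P]%fset =>
     \sum_(k <- finsupp P | k.2 == j) P k * x0 ^ k.1].

(* Max of - j over the exponents j < 0 that occur; 0 when there is no pole at 0. *)
Definition pole_order (f : laurent1) : nat :=
  \max_(j <- finsupp f) absz (Num.min j 0).

(* The polynomial x ^ (pole_order f) * f(x): it has the same zeros as f in C^*,
   with the same multiplicities. *)
Definition clear_pole (f : laurent1) : {poly C} :=
  \sum_(j <- finsupp f) f j *: 'X^(absz (j + (pole_order f)%:Z)).

Definition zeros_in_disc (f : laurent1) (a : R) : nat :=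
  (\sum_(z \in [set z : C | (0 < `|z| < a%:C)%R]) mup z (clear_pole f))%N.

Definition nu (f : laurent1) (a : R) : int :=
  (zeros_in_disc f a)%:Z - (pole_order f)%:Z.

Definition nu1 (Q : laurent2) (a b : R) (r : C) : int :=
  nu (slice1 (const_sub r Q) b%:C) a.

Definition nu2 (Q : laurent2) (a b : R) (r : C) : int :=
  nu (slice2 (const_sub r Q) a%:C) b.

Definition torus_image (Q : laurent2) (a b : R) : set C^o :=
  [set z | exists x y : C, [/\ `|x| = a%:C, `|y| = b%:C & z = eval2 Q x y]].

(* The union of the unbounded components of the complement of K; for compact K
   there is exactly one such component. *)
Definition unbounded_component (K : set C^o) : set C^o :=
  [set r | ~ bounded_set (connected_component (~` K) r)].

Definition circle_point (a t : R) : C := (a * cos t) +i* (a * sin t).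

(* With x = a e^(i s), y = b e^(i t) one has dx/x = i ds and dy/y = i dt, so the
   factor (2 pi i)^-2 becomes (2 pi)^-2. The integral is extended-real valued,
   with log 0 = -oo. *)
Definition mahler (a b : R) (P : C -> C -> C) : \bar R :=
  (((2 * pi) ^- 2)%:E *
   \int[(@lebesgue_measure R \x @lebesgue_measure R)%E]_(p in
       `[0%R, (2 * pi)%R] `*` `[0%R, (2 * pi)%R])
     lne (complex.Re `|P (circle_point a p.1) (circle_point b p.2)|)%:E)%E.

End Laurent.

(* Main.v *)
Require Import Defs.
From HB Require Import structures.
From mathcomp Require Import all_boot all_order all_algebra finmap.
From mathcomp Require Import complex ring lra zify.
From mathcomp Require Import all_classical all_reals all_analysis.
From mathcomp Require Import measurable_realfun.

Set Implicit Arguments.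
Unset Strict Implicit.
Unset Printing Implicit Defensive.

Import Order.TTheory GRing.Theory Num.Theory.
Import numFieldNormedType.Exports.

Local Open Scope classical_set_scope.
Local Open Scope ring_scope.
Local Open Scope complex_scope.

(* On the unbounded component the integers nu1 and nu2 vanish: the number of
   roots is locally constant in r and equals the pole order for large r. The
   claim then says that the Ronkin function (s, t) |-> m_{exp s, exp t}(Q_r)
   takes the same value at (ln a, ln b) and at (0, 0), which holds because it is
   convex with zero gradient at both points, so that both are minima.

   Convexity enters only through Jensen's formula along the curves
   u |-> Q_r (x u^v, y u^w) with v and w integral, in discrete form: averages
   over the n-th roots of unity are computed exactly by
   prod_l (rho w^l - z) = +- (rho^n - z^n), and the n x n grid on the torus is
   invariant under translation along such a curve. The Mahler measures are the
   limits of the grid averages of ln |Q_r|, which is Lipschitz on both tori. *)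

(** Along a curve [u |-> (x u^v, y u^w)], Jensen's formula turns the mean of [ln |Q_r|] over
    [|u| = rho] into a constant plus [ln (max rho |z|)] for each root [z] of the polynomial
    [u^M Q_r (x u^v, y u^w)], minus [M ln rho]. As a function of [ln rho], each of these terms lies
    above its supporting line at [rho = 1], of slope 1 if [|z| < 1] and 0 otherwise. Exactly [M]
    roots lie in the unit disc, so the slopes cancel [M ln rho], and an inequality between two tori
    remains. Two obstacles shape the rest. Integral directions only lead to radii near the
    prescribed ones, so the comparison ends on a nearby torus where [Q_r] is still bounded away from
    0. And [rho^n - z^n] has the expected size only if [|z|] stays away from [rho]: a zero-free
    annulus supplies a ratio [theta < 1], and then each root costs a factor of at most 4 for all
    large [n]. The total cost is of order [n] in a grid sum of [n^2] terms and vanishes in the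
    limit. *)

Section Modulus.
Variable R : realType.
Local Notation C := R[i].
Implicit Types (z w : C) (x t : R).

(** The norm of [R[i]] has values in [R[i]]; this is the modulus as a real number, in the form in
    which [mahler] uses it. *)
Definition cabs (z : C) : R := complex.Re `|z|.

Lemma normE z : `|z| = (cabs z)%:C.
Proof. by rewrite /cabs normc_def. Qed.

Lemma cabsE z : cabs z = Num.sqrt (complex.Re z ^+ 2 + complex.Im z ^+ 2).
Proof. by rewrite /cabs normc_def. Qed.

Lemma cabs_ge0 z : 0 <= cabs z.
Proof. by rewrite cabsE sqrtr_ge0. Qed.

Lemma cabsM z w : cabs (z * w) = cabs z * cabs w.
Proof. by apply: (@complexI R); rewrite rmorphM -!normE normrM. Qed.

Lemma cabs1 : cabs 1 = 1.
Proof. by rewrite /cabs normr1. Qed.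

Lemma cabs_eq0 z : (cabs z == 0) = (z == 0).
Proof. by rewrite -(inj_eq (@complexI R)) -normE normr_eq0. Qed.

Lemma cabs0 : cabs 0 = 0.
Proof. by apply/eqP; rewrite cabs_eq0. Qed.

Lemma cabs_gt0 z : (0 < cabs z) = (z != 0).
Proof. by rewrite lt0r cabs_ge0 cabs_eq0 andbT. Qed.

Lemma ler_cabsD z w : cabs (z + w) <= cabs z + cabs w.
Proof. by rewrite -lecR rmorphD -!normE ler_normD. Qed.

Lemma cabsN z : cabs (- z) = cabs z.
Proof. by rewrite /cabs normrN. Qed.

Lemma ler_cabsB z w : cabs z - cabs w <= cabs (z - w).
Proof. by rewrite lerBlDr -{1}(subrK w z) ler_cabsD. Qed.

Lemma cabsBC z w : cabs (z - w) = cabs (w - z).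
Proof. by rewrite -cabsN opprB. Qed.

Lemma ler_dist_cabs z w : `|cabs z - cabs w| <= cabs (z - w).
Proof. by rewrite ler_norml ler_cabsB lerNl opprB cabsBC ler_cabsB. Qed.

Lemma ler_cabsBD z w : cabs (z - w) <= cabs z + cabs w.
Proof. by rewrite -(cabsN w) ler_cabsD. Qed.

Lemma cabsV z : cabs z^-1 = (cabs z)^-1.
Proof. by apply: (@complexI R); rewrite fmorphV -!normE normfV. Qed.

Lemma cabsX z n : cabs (z ^+ n) = cabs z ^+ n.
Proof. by elim: n => [|n ih]; rewrite ?cabs1 // !exprS cabsM ih. Qed.

Lemma cabs_prod I (r : seq I) (F : I -> C) :
  cabs (\prod_(i <- r) F i) = \prod_(i <- r) cabs (F i).
Proof. exact: (big_morph cabs cabsM cabs1). Qed.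

Lemma ler_cabs_sum I (r : seq I) (F : I -> C) :
  cabs (\sum_(i <- r) F i) <= \sum_(i <- r) cabs (F i).
Proof.
elim: r => [|i r ih]; first by rewrite !big_nil cabs0.
by rewrite !big_cons (le_trans (ler_cabsD _ _)) // lerD2l.
Qed.

Lemma cabsR x : cabs x%:C = `|x|.
Proof. by rewrite cabsE /= expr0n addr0 sqrtr_sqr. Qed.

Lemma cabsXz z (k : int) : cabs (z ^ k) = cabs z ^ k.
Proof. by case: k => n; rewrite ?NegzE ?exprnN ?exprz_inv /= -?exprnP ?exprnN ?cabsV cabsX. Qed.

Lemma cabs_nat n : cabs n%:R = n%:R.
Proof. by rewrite -(rmorph_nat (real_complex R)) cabsR ger0_norm. Qed.

Lemma cabs_le_ReIm z : cabs z <= `|complex.Re z| + `|complex.Im z|.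
Proof.
rewrite cabsE -(ler_sqr (x:=_)) ?nnegrE ?sqrtr_ge0 ?addr_ge0 //.
rewrite sqr_sqrtr ?addr_ge0 ?sqr_ge0 // sqrrD !real_normK ?num_real //.
by rewrite addrAC lerDl mulrn_wge0 // mulr_ge0.
Qed.

(** * Circles in angular coordinates *)

Definition cis t : C := (cos t) +i* (sin t).

Lemma circle_pointE x t : circle_point x t = x%:C * cis t.
Proof. by rewrite /circle_point /cis; simpc. Qed.

Lemma cis0 : cis 0 = 1.
Proof. by rewrite /cis cos0 sin0. Qed.

Lemma cisD s t : cis (s + t) = cis s * cis t.
Proof. by rewrite /cis cosD sinD; simpc; congr (_ +i* _); rewrite addrC mulrC. Qed.

Lemma cabs_cis t : cabs (cis t) = 1.
Proof. by rewrite cabsE /= cos2Dsin2 sqrtr1. Qed.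

Lemma cis_neq0 t : cis t != 0.
Proof. by rewrite -cabs_gt0 cabs_cis. Qed.

Lemma cisN t : cis (- t) = (cis t)^-1.
Proof.
apply: (mulfI (cis_neq0 t)); rewrite -cisD subrr cis0 divff //.
exact: cis_neq0.
Qed.

Lemma cisX t n : cis t ^+ n = cis (n%:R * t).
Proof.
elim: n => [|n ih]; first by rewrite mul0r cis0.
by rewrite exprS ih -cisD -[X in cis (X + _)]mul1r -mulrDl addrC -natr1.
Qed.

Lemma cisXz t (k : int) : cis t ^ k = cis (k%:~R * t).
Proof.
case: k => n; first by rewrite -exprnP cisX.
by rewrite NegzE -exprnN -exprVn -cisN cisX mulrN mulrNz mulNr.
Qed.

Lemma cis_2pi : cis (2 * pi) = 1.
Proof. by rewrite /cis mulr_natl cos2pi sin2pi. Qed.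

Lemma dist_cos_le s t : `|cos s - cos t| <= `|s - t|.
Proof.
wlog le_ts : s t / t <= s.
  by move=> H; case: (leP t s) => [/H//|/ltW/H]; rewrite distrC (distrC s).
have [c _ ->] := @MVT_segment R cos (fun x => - sin x) t s le_ts
  (fun x _ => is_derive_cos x) (fun x => @continuous_subspaceT _ _ _ _ (@continuous_cos R) x).
by rewrite normrM ler_piMl // normrN sin_max.
Qed.

Lemma dist_sin_le s t : `|sin s - sin t| <= `|s - t|.
Proof.
have sinE x : sin x = cos (x - pi / 2) by rewrite cosBpihalf.
by rewrite !sinE (le_trans (dist_cos_le _ _)) // opprB addrA subrK.
Qed.

(** The factor 2 is the price of treating real and imaginary parts separately, each being
    1-Lipschitz. *)
Lemma dist_cis_le s t : cabs (cis s - cis t) <= 2 * `|s - t|.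
Proof.
rewrite (le_trans (cabs_le_ReIm _)) // mulr_natl mulr2n.
by rewrite lerD ?dist_cos_le ?dist_sin_le.
Qed.

Lemma cis_neq1 t : 0 < t < 2 * pi -> cis t != 1.
Proof.
move=> /andP[t0 tpi]; apply/eqP => -[ct _].
(* By the half-angle formula, [cos t = 1 - 2 sin^2 (t / 2)], which is below 1. *)
have : 0 < sin (t / 2) by rewrite sin_gt0_pi //; apply/andP; split; lra.
have := cosD (t / 2) (t / 2); rewrite -splitr ct.
have := cos2Dsin2 (t / 2); nra.
Qed.

Lemma polar z : exists2 t, 0 <= t <= 2 * pi & z = circle_point (cabs z) t.
Proof.
have pi0 := pi_ge0 R.
have [->|z0] := eqVneq z 0.
  by exists 0; [lra|rewrite circle_pointE cabs0 mul0r].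
have m0 : 0 < cabs z by rewrite cabs_gt0.
pose x := complex.Re z / cabs z; pose y := complex.Im z / cabs z.
have xy : x ^+ 2 + y ^+ 2 = 1.
  rewrite /x /y !expr_div_n -mulrDl cabsE sqr_sqrtr ?addr_ge0 ?sqr_ge0 //.
  rewrite divff // -(sqr_sqrtr (addr_ge0 (sqr_ge0 _) (sqr_ge0 _))) -cabsE.
  by rewrite sqrf_eq0 cabs_eq0.
have zE : z = (cabs z * x) +i* (cabs z * y).
  by rewrite /x /y !(mulrC (cabs z)) !divfK ?gt_eqF //; case: (z).
have x1 : -1 <= x <= 1 by apply/andP; split; nra.
have [a0 ca] := acos_def x1.
have sa : sin (acos x) = `|y|.
  rewrite sin_acos // -sqrtr_sqr; congr Num.sqrt; rewrite -xy; ring.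
(* [acos x] lies in [[0, pi]] and serves the upper half-plane; in the lower one the angle is
   [2 pi - acos x]. *)
have [y0|y0] := leP 0 y.
  exists (acos x); first lra.
  by rewrite {1}zE /circle_point ca sa ger0_norm.
exists (- acos x + pi *+ 2); first by rewrite mulr2n; lra.
by rewrite {1}zE /circle_point cosD2pi sinD2pi cosN sinN ca sa ltr0_norm // opprK.
Qed.

(** If the order [m] were less than [n], the angle [2 pi m / n] would lie strictly between 0 and
    [2 pi], where [cis] is never 1. *)
Lemma prim_root_cis n : (0 < n)%N -> n.-primitive_root (cis (2 * pi / n%:R)).
Proof.
move=> n0; have nR : (n%:R : R) != 0 by rewrite pnatr_eq0 -lt0n.
have cn : cis (2 * pi / n%:R) ^+ n = 1 by rewrite cisX mulrC divfK // cis_2pi.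
have [m mp] := prim_order_exists n0 cn => mn.
have m0 := prim_order_gt0 mp.
suff mn_eq : m = n by rewrite -{1}mn_eq.
apply/eqP; rewrite eqn_leq (dvdn_leq n0 mn) leqNgt /=; apply/negP => mlt.
have := prim_expr_order mp; rewrite cisX; apply/eqP/cis_neq1.
have pi0 := pi_gt0 R.
rewrite mulr_gt0 ?divr_gt0 ?ltr0n ?mulr_gt0 //=.
rewrite mulrCA -[X in _ < X]mulr1 ltr_pM2l ?mulr_gt0 //.
by rewrite ltr_pdivrMr ?ltr0n // mul1r ltr_nat.
Qed.
End Modulus.

(** * Counting the roots of a polynomial in a disc by means over roots of unity *)

Section RootCount.
Variable R : realType.
Local Notation C := R[i].
Implicit Types (p : {poly C}) (z w u : C) (a : R).

(** The derivative of [log p] with respect to [log u]: a root at 0 contributes the constant 1. *)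
Definition logder p u : C := u * p^`().[u] / p.[u].

Definition poly_roots p : seq C := sval (closed_field_poly_normal p).

(** Multiplicities are counted, and so is the root 0, which [zeros_in_disc] leaves out. *)
Definition nroots p a : nat := count (fun z => cabs z < a) (poly_roots p).

Lemma poly_rootsE p : p = lead_coef p *: \prod_(z <- poly_roots p) ('X - z%:P).
Proof. by rewrite /poly_roots; case: closed_field_poly_normal. Qed.

Lemma mem_poly_roots p z : p != 0 -> (z \in poly_roots p) = (p.[z] == 0).
Proof.
move=> p0; rewrite -root_prod_XsubC -/(root p z) [in RHS](poly_rootsE p).
by rewrite rootZ // lead_coef_eq0.
Qed.

Lemma size_poly_roots p : p != 0 -> size p = (size (poly_roots p)).+1.
Proof.
move=> p0; rewrite {1}(poly_rootsE p) size_scale ?lead_coef_eq0 //.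
by rewrite size_prod_XsubC.
Qed.

Lemma logder_prod p u : p.[u] != 0 ->
  logder p u = \sum_(z <- poly_roots p) u / (u - z).
Proof.
move=> pu0; have p0 : p != 0 by apply: contraNneq pu0 => ->; rewrite horner0.
have lp : lead_coef p != 0 by rewrite lead_coef_eq0.
have {pu0} : all (fun z => u - z != 0) (poly_roots p).
  apply/allP => z; rewrite mem_poly_roots // => /eqP pz.
  by rewrite subr_eq0; apply: contraNneq pu0 => ->; rewrite pz.
move: lp (poly_rootsE p); move: (lead_coef p) (poly_roots p) => c s c0 pE.
rewrite /logder pE derivZ !hornerZ [u * (_ * _)]mulrCA -mulf_div divff // mul1r.
elim: s {pE} => [|z s ih] /=; first by rewrite !big_nil derivC horner0 mulr0 mul0r.
case/andP => uz us; rewrite !big_cons derivM derivXsubC mul1r !hornerE -ih //.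
have : (\prod_(j <- s) ('X - j%:P)).[u] != 0.
  rewrite horner_prod prodf_seq_neq0; apply: sub_all us => y.
  by rewrite !hornerE.
move: (\prod_(j <- s) ('X - j%:P)) => q qu; field; by rewrite qu uz.
Qed.

Lemma sum_prim_root_eq0 (F : fieldType) n k (w : F) : n.-primitive_root w ->
  (0 < k < n)%N -> \sum_(l < n) (w ^+ l) ^+ k = 0.
Proof.
move=> pw /andP[k0 kn]; have wk : w ^+ k - 1 != 0.
  rewrite subr_eq0 -(prim_order_dvd pw); apply/negP => /(dvdn_leq k0).
  by rewrite leqNgt kn.
apply: (mulfI wk); rewrite mulr0.
under eq_bigr => l _ do rewrite exprAC.
by rewrite -subrX1 exprAC (prim_expr_order pw) expr1n subrr.
Qed.

(** Multiplying by [1 - v^n = (w^l)^n - v^n] makes each quotient a polynomial in [w^l]; in the sum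
    over [l] only the power [(w^l)^n = 1] survives. *)
Lemma sum_prim_root_div (F : fieldType) n (w v : F) : n.-primitive_root w ->
  v ^+ n != 1 ->
  \sum_(l < n) w ^+ l / (w ^+ l - v) = n%:R / (1 - v ^+ n).
Proof.
move=> pw vn; have n0 := prim_order_gt0 pw.
have vn' : 1 - v ^+ n != 0 by rewrite subr_eq0 eq_sym.
apply: (mulIf vn'); rewrite divfK // mulr_suml.
have wl (l : 'I_n) : w ^+ l / (w ^+ l - v) * (1 - v ^+ n) =
    \sum_(i < n) (w ^+ l) ^+ (n - i) * v ^+ i.
  have wn : (w ^+ l) ^+ n = 1 by rewrite exprAC (prim_expr_order pw) expr1n.
  have wv : w ^+ l - v != 0.
    by rewrite subr_eq0; apply: contraNneq vn => <-; rewrite wn.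
  rewrite -[in X in _ * X]wn subrXX mulrA divfK // mulr_sumr; apply: eq_bigr => i _.
  by rewrite mulrA -exprS -subSn ?prednK // -ltnS prednK.
under eq_bigr => l _ do rewrite wl.
rewrite exchange_big /=.
case: n n0 pw vn vn' wl => // n _ pw _ _ _.
rewrite big_ord_recl /= [X in _ + X]big1 ?addr0.
  under eq_bigr => l _ do rewrite subn0 expr0 mulr1 exprAC (prim_expr_order pw) expr1n.
  by rewrite sumr_const card_ord.
move=> i _; rewrite -mulr_suml (sum_prim_root_eq0 pw) ?mul0r //.
by rewrite subSS subn_gt0 ltn_ord /= ltnS leq_subr.
Qed.

Lemma near_expr_le (x e : R) : 0 <= x < 1 -> 0 < e ->
  \forall n \near \oo, x ^+ n <= e.
Proof.
move=> /andP[x0 x1] e0; have x1' : `|x| < 1 by rewrite ger0_norm.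
have /cvgrPdist_le/(_ e e0) := cvg_expr x1'.
by apply: filterS => n; rewrite sub0r normrN ger0_norm // exprn_ge0.
Qed.

(** Up to sign, the deviation from the limit is [v / (1 - v)], with [v = w^n] inside the unit disc
    and [v = w^-n] outside, so [key] settles both cases. *)
Lemma near_inv1BX w (e : R) : cabs w != 1 -> 0 < e ->
  \forall n \near \oo, cabs ((1 - w ^+ n)^-1 - (cabs w < 1)%R%:R) <= e.
Proof.
move=> w1 e0.
have key v : cabs v <= 2^-1 -> cabs v <= e / 2 -> cabs (v / (1 - v)) <= e.
  move=> v2 ve; have := ler_cabsB 1 v; rewrite cabs1 => v1.
  have d0 : 2^-1 <= cabs (1 - v) by lra.
  rewrite cabsM cabsV ler_pdivrMr; last by lra.
  by rewrite (le_trans ve) // ler_pM2l.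
have [wl|wl|/eqP] := ltgtP (cabs w) 1; last by rewrite (negbTE w1).
  have w01 : 0 <= cabs w < 1 by rewrite cabs_ge0.
  near=> n.
  have n2 : cabs w ^+ n <= 2^-1 by near: n; apply: near_expr_le; rewrite ?invr_gt0.
  have -> : (1 - w ^+ n)^-1 - 1 = w ^+ n / (1 - w ^+ n).
    have d0 : 1 - w ^+ n != 0.
      rewrite subr_eq0; apply/eqP => wn1; move: n2; rewrite -cabsX -wn1 cabs1; lra.
    by field.
  apply: key; rewrite cabsX //.
  by near: n; apply: near_expr_le; rewrite ?divr_gt0.
have w0 : w != 0 by rewrite -cabs_gt0; lra.
have w01 : 0 <= cabs w^-1 < 1 by rewrite cabs_ge0 cabsV invf_lt1 // cabs_gt0.
near=> n.
have n2 : cabs w^-1 ^+ n <= 2^-1 by near: n; apply: near_expr_le; rewrite ?invr_gt0.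
have -> : (1 - w ^+ n)^-1 - 0 = - (w^-1 ^+ n / (1 - w^-1 ^+ n)).
  have d0 : w ^+ n - 1 != 0.
    rewrite subr_eq0; apply/eqP => wn1; move: n2.
    rewrite -cabsX exprVn wn1 invr1 cabs1; lra.
  rewrite exprVn; field.
  by rewrite d0 expf_neq0 //= -opprB oppr_eq0.
rewrite cabsN; apply: key; rewrite cabsX //.
by near: n; apply: near_expr_le; rewrite ?divr_gt0.
Unshelve. all: by end_near. Qed.

Lemma near_sum_inv1BX (s : seq C) a (e : R) : 0 < a ->
  all (fun z => cabs z != a) s -> 0 < e ->
  \forall n \near \oo, cabs (\sum_(z <- s) (1 - (z / a%:C) ^+ n)^-1
                              - (count (fun z => cabs z < a) s)%:R) <= e.
Proof.
move=> a0; elim: s e => [|z s ih] e /=.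
  by move=> _ e0; near=> n; rewrite big_nil subrr cabs0 ltW.
move=> /andP[za sa] e0; have e20 : 0 < e / 2 by rewrite divr_gt0.
have czE : cabs (z / a%:C) = cabs z / a by rewrite cabsM cabsV cabsR gtr0_norm.
have za1 : cabs (z / a%:C) != 1.
  rewrite czE; apply: contra za => /eqP h.
  by rewrite -(divfK (lt0r_neq0 a0) (cabs z)) h mul1r.
have := near_inv1BX za1 e20; rewrite czE ltr_pdivrMr // mul1r => h1.
have h2 := ih _ sa e20.
near=> n; rewrite big_cons natrD opprD addrACA (le_trans (ler_cabsD _ _)) //.
rewrite (splitr e) lerD //; first by near: n.
by near: n.
Unshelve. all: by end_near. Qed.

(** Exact for every positive [n]: a root [z] contributes [sum_prim_root_div] at [v = z / a]. *)
Lemma mean_logder p a n : 0 < a -> (0 < n)%N ->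
  (forall u, cabs u = a -> p.[u] != 0) ->
  \sum_(l < n) logder p (a%:C * cis (2 * pi / n%:R) ^+ l) =
  n%:R * \sum_(z <- poly_roots p) (1 - (z / a%:C) ^+ n)^-1.
Proof.
move=> a0 n0 pa; have pw := prim_root_cis R n0.
have aC0 : a%:C != 0 by rewrite -cabs_gt0 cabsR normr_gt0 gt_eqF.
have p0 : p != 0.
  have : p.[a%:C] != 0 by rewrite pa // cabsR gtr0_norm.
  by apply: contraNneq => ->; rewrite horner0.
under eq_bigr => l _.
  rewrite logder_prod; last first.
    by rewrite pa // cabsM cabsR gtr0_norm // cabsX cabs_cis expr1n mulr1.
  over.
rewrite exchange_big /= mulr_sumr; apply: eq_big_seq => z zs.
rewrite -(sum_prim_root_div pw); last first.
  apply/eqP => /(congr1 (@cabs R)); rewrite cabsX cabs1 => /eqP.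
  rewrite pexpr_eq1 ?cabs_ge0 // cabsM cabsV cabsR gtr0_norm // => /eqP h.
  have : cabs z = a by rewrite -(divfK (lt0r_neq0 a0) (cabs z)) h mul1r.
  by move/pa; rewrite -mem_poly_roots // zs.
apply: eq_bigr => l _.
rewrite -[X in _ / (_ - X)](divfK aC0) (mulrC (z / _)) -mulrBr.
by rewrite -mulf_div divff // mul1r.
Qed.

(* The mean of [logder p] over the n-th roots of unity tends to the number of
   roots inside the circle, which replaces the argument principle. *)
Lemma eq_nroots p1 p2 a : 0 < a ->
  (forall u, cabs u = a -> p1.[u] != 0) ->
  (forall u, cabs u = a -> p2.[u] != 0) ->
  (forall u, cabs u = a -> cabs (logder p1 u - logder p2 u) <= 2^-1) ->
  nroots p1 a = nroots p2 a.
Proof.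
move=> a0 h1 h2 h12.
have off p : (forall u, cabs u = a -> p.[u] != 0) ->
    all (fun z => cabs z != a) (poly_roots p).
  move=> hp; have p0 : p != 0.
    have : p.[a%:C] != 0 by rewrite hp // cabsR gtr0_norm.
    by apply: contraNneq => ->; rewrite horner0.
  apply/allP => z; rewrite mem_poly_roots // => pz.
  by apply/eqP => /hp; rewrite pz.
(* The three errors add up to 3/4, and two natural numbers at distance less than 1 are equal. *)
have e0 : 0 < 8^-1 :> R by rewrite invr_gt0.
pose S p n := \sum_(z <- poly_roots p) (1 - (z / a%:C) ^+ n)^-1 : C.
near \oo => n.
have n0 : (0 < n)%N by near: n; exists 1%N.
have l1 : cabs (S p1 n - (nroots p1 a)%:R) <= 8^-1.
  by near: n; apply: near_sum_inv1BX => //; exact: off.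
have l2 : cabs (S p2 n - (nroots p2 a)%:R) <= 8^-1.
  by near: n; apply: near_sum_inv1BX => //; exact: off.
have l12 : cabs (S p1 n - S p2 n) <= 2^-1.
  rewrite -(ler_pM2l (x := n%:R)) ?ltr0n // -{1}(cabs_nat R n) -cabsM mulrBr.
  rewrite -!mean_logder // -sumrB (le_trans (ler_cabs_sum _ _)) //.
  have -> : n%:R * 2^-1 = \sum_(l < n) 2^-1 :> R.
    by rewrite sumr_const card_ord mulr_natl.
  rewrite ler_sum // => l _.
  by rewrite h12 // cabsM cabsR gtr0_norm // cabsX cabs_cis expr1n mulr1.
have : cabs ((nroots p1 a)%:R - (nroots p2 a)%:R : C) <= 8^-1 + 2^-1 + 8^-1.
  have := ler_cabsD ((nroots p1 a)%:R - S p1 n + (S p1 n - S p2 n)) (S p2 n - (nroots p2 a)%:R).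
  rewrite [in leLHS]subrKA [in leLHS]subrKA => /le_trans; apply.
  rewrite lerD // (le_trans (ler_cabsD _ _)) // lerD // cabsBC //.
have natE k m : cabs ((k : nat)%:R - (m : nat)%:R : C) = `|k%:R - m%:R|.
  by rewrite -!(rmorph_nat (real_complex R)) -rmorphB cabsR.
rewrite natE => d; apply/eqP; rewrite eqn_leq.
have half k m : `|(k%:R : R) - m%:R| <= 8^-1 + 2^-1 + 8^-1 -> (k <= m)%N.
  rewrite leqNgt => kmd; apply/negP => mk.
  have : (m.+1%:R : R) <= k%:R by rewrite ler_nat.
  rewrite -natr1; move: kmd; rewrite ler_norml => /andP[_]; lra.
by rewrite (half _ _ d) half // distrC.
Unshelve. all: by end_near. Qed.
End RootCount.

(** * The root count on the unbounded component *)

Section UnboundedComponent.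
Variable R : realType.
Local Notation C := R[i].
Implicit Types (p : {poly C}) (u : C) (a : R).

Lemma poly_circle_bound p a : 0 <= a ->
  exists2 B, 0 <= B & forall u, cabs u = a -> cabs p.[u] <= B.
Proof.
move=> a0; exists (\sum_(i < size p) cabs p`_i * a ^+ i).
  by rewrite sumr_ge0 // => i _; rewrite mulr_ge0 ?cabs_ge0 ?exprn_ge0.
move=> u ua; rewrite horner_coef (le_trans (ler_cabs_sum _ _)) // ler_sum // => i _.
by rewrite cabsM cabsX ua.
Qed.

Lemma nroots_Xn (M : nat) a : 0 < a -> nroots ('X^M : {poly C}) a = M.
Proof.
move=> a0; have X0 : ('X^M : {poly C}) != 0 by rewrite -size_poly_gt0 size_polyXn.
have := size_poly_roots X0; rewrite size_polyXn => -[sM].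
rewrite /nroots [in RHS]sM; apply/eqP; rewrite -all_count; apply/allP => z.
rewrite mem_poly_roots // hornerXn expf_eq0 => /andP[_ /eqP ->].
by rewrite cabs0.
Qed.

Lemma logder_Xn (M : nat) u : u != 0 -> logder ('X^M : {poly C}) u = M%:R.
Proof.
move=> u0; rewrite /logder derivXn !hornerE ?hornerMn ?hornerXn.
case: M => [|M]; first by rewrite mulr0n mulr0 mul0r.
by rewrite /= mulrnAr -exprS -mulr_natl mulfK // expf_neq0.
Qed.

(* Moving [r] to [s] inside the component replaces [p] by [p + (s - r) X^M]; the
   number of roots is locally constant in [s], and it is [M] for large [s]. *)
Lemma nroots_unbounded (K : set C^o) p (M : nat) a (r : C) : 0 < a ->
  (forall s, ~ K s -> exists2 d, 0 < d & forall w, K w -> d <= cabs (s - w)) ->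
  (forall u, cabs u = a -> K (r - p.[u] / u ^+ M)) ->
  unbounded_component K r ->
  nroots p a = M.
Proof.
move=> a0 sepK pK ubK.
(* On the circle [h u] is a point of [K] and [q s] equals [u^M (s - h u)], so [q s] has no root
   there as long as [s] is off [K]. *)
pose h u := r - p.[u] / u ^+ M.
pose q s := p + (s - r)%:P * 'X^M.
have un0 u : cabs u = a -> u != 0 by move=> ua; rewrite -cabs_gt0 ua.
have qE s u : cabs u = a -> (q s).[u] = u ^+ M * (s - h u).
  move=> ua; rewrite /q /h !hornerE ?hornerXn; field.
  by rewrite expf_neq0 // un0.
(* In [u q' - M q] the term in [X^M] cancels, so [E] is the same for all [s], and [logder (q s)]
   depends on [s] only through a denominator. *)
pose E := 'X * p^`() - M%:R *: p.
have lqE s u : cabs u = a -> s != h u ->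
    logder (q s) u = M%:R + E.[u] / (u ^+ M * (s - h u)).
  move=> ua sh; have u0 := un0 u ua; rewrite /logder -qE //.
  have q0 : (q s).[u] != 0.
    by rewrite qE // mulf_neq0 ?expf_neq0 // subr_eq0.
  apply: (mulIf q0); rewrite mulrDl !divfK // /q /E !hornerE ?hornerXn.
  rewrite derivD derivM derivC mul0r add0r derivXn !hornerE ?hornerMn ?hornerXn.
  case: M {pK h q E qE sh q0} => [|M]; first by rewrite !mulr0n /=; ring.
  by rewrite /= exprS -mulr_natl; ring.
have aM0 : 0 < a ^+ M by rewrite exprn_gt0.
have [B B0 EB] := poly_circle_bound E (ltW a0).
have [H H0 hH] : exists2 H, 0 <= H & forall u, cabs u = a -> cabs (h u) <= H.
  have [H H0 pH] := poly_circle_bound p (ltW a0).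
  exists (cabs r + H / a ^+ M); first by rewrite addr_ge0 ?cabs_ge0 ?divr_ge0 // ltW.
  move=> u ua; rewrite (le_trans (ler_cabsBD _ _)) // lerD2l cabsM cabsV cabsX ua.
  by rewrite ler_pM2r ?invr_gt0 // pH.
pose far s := exists2 d, 0 < d & forall u, cabs u = a -> d <= cabs (s - h u).
have far_neq s u : far s -> cabs u = a -> s != h u.
  by move=> [d d0 sd] ua; rewrite -subr_eq0 -cabs_gt0 (lt_le_trans d0) // sd.
have far_root s u : far s -> cabs u = a -> (q s).[u] != 0.
  move=> sf ua; rewrite qE // mulf_neq0 ?expf_neq0 ?(un0 u ua) // subr_eq0.
  exact: far_neq.
have near_s s : far s -> exists2 e, 0 < e & forall t, cabs (s - t) < e ->
    far t /\ nroots (q t) a = nroots (q s) a.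
  (* The first bound keeps [t] at distance [d / 2] from the values of [h], the second makes the
     values of [logder] differ by at most [2^-1]; [B + 1] guards against [B = 0]. *)
  move=> [d d0 sd]; pose e := Num.min (d / 2) (a ^+ M * d ^+ 2 / (4 * (B + 1))).
  have e0 : 0 < e.
    by rewrite lt_min !divr_gt0 ?mulr_gt0 ?exprn_gt0 // ltr_wpDl.
  exists e => // t; rewrite lt_min => /andP[st1 st2].
  have td u : cabs u = a -> d / 2 <= cabs (t - h u).
    move=> ua; have := sd u ua.
    by have := ler_cabsD (s - t) (t - h u); rewrite addrA subrK; lra.
  have tf : far t by exists (d / 2); rewrite ?divr_gt0.
  have sf : far s by exists d.
  split=> //; apply: eq_nroots => // u ua; [exact: far_root|exact: far_root|].
  have u0 := un0 u ua; have sh := far_neq s u sf ua; have th := far_neq t u tf ua.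
  have dE (x y z : C) : x + y - (x + z) = y - z by ring.
  rewrite !lqE // dE.
  have -> : E.[u] / (u ^+ M * (t - h u)) - E.[u] / (u ^+ M * (s - h u)) =
      E.[u] * (s - t) / (u ^+ M * ((t - h u) * (s - h u))).
    by field; rewrite expf_neq0 // !subr_eq0 sh th.
  rewrite cabsM cabsV !cabsM cabsX ua.
  have st := td u ua; have ss := sd u ua; have Eu := EB u ua.
  rewrite ler_pdivrMr; last first.
    by rewrite !mulr_gt0 //; [apply: lt_le_trans st; rewrite divr_gt0|apply: lt_le_trans ss].
  have c1 : d / 2 * d <= cabs (t - h u) * cabs (s - h u).
    by rewrite ler_pM // ?divr_ge0 // ltW.
  have c2 : cabs E.[u] * cabs (s - t) <= (B + 1) * (a ^+ M * d ^+ 2 / (4 * (B + 1))).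
    by rewrite ler_pM ?cabs_ge0 // ?ltW //; apply: le_lt_trans Eu _; rewrite ltrDl.
  rewrite (le_trans c2) //.
  have -> : (B + 1) * (a ^+ M * d ^+ 2 / (4 * (B + 1))) = 2^-1 * (a ^+ M * (d / 2 * d)).
    by field; rewrite lt0r_neq0 // ltr_wpDl.
  by rewrite ler_pM2l ?invr_gt0 // ler_pM2l.
(* Beyond this bound [E / (u^M (s - h u))] has modulus at most [2^-1] on the circle, so [q s] has as
   many roots in the disc as [X^M]. *)
have large s : H + 2 * B / a ^+ M + 1 < cabs s -> far s /\ nroots (q s) a = M.
  move=> sB; have BM0 : 0 <= 2 * B / a ^+ M by rewrite divr_ge0 ?mulr_ge0 // ltW.
  have sd u : cabs u = a -> 2 * B / a ^+ M + 1 <= cabs (s - h u).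
    by move=> ua; have := ler_cabsB s (h u); have := hH u ua; lra.
  have sf : far s by exists (2 * B / a ^+ M + 1) => //; rewrite ltr_wpDl.
  split=> //; rewrite -[RHS](nroots_Xn M a0); apply: eq_nroots => // u ua.
  - exact: far_root.
  - by rewrite hornerXn expf_neq0 // un0.
  have u0 := un0 u ua; have sh := far_neq s u sf ua.
  rewrite lqE // logder_Xn // addrAC subrr add0r cabsM cabsV cabsM cabsX ua.
  have := sd u ua; have := EB u ua => Eu su.
  rewrite ler_pdivrMr; last by rewrite mulr_gt0 // (lt_le_trans _ su) // ltr_wpDl.
  rewrite (le_trans Eu) //.
  have -> : B = 2^-1 * (a ^+ M * (2 * B / a ^+ M)) by field; rewrite gt_eqF.
  by rewrite ler_pM2l ?invr_gt0 // ler_pM2l //; lra.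
pose A := connected_component (~` K) r.
have [s As sB] : exists2 s, A s & H + 2 * B / a ^+ M + 1 < cabs s.
  apply: contrapT => nA; apply: ubK.
  exists (H + 2 * B / a ^+ M + 1)%:C; split.
    by apply/complex_realP; exists (H + 2 * B / a ^+ M + 1).
  move=> x Bx s As /=; rewrite (le_trans _ (ltW Bx)) // normE lecR leNgt.
  by apply/negP => sB; apply: nA; exists s.
have AK s' : A s' -> far s'.
  move=> /connected_component_sub/sepK[d d0 sd]; exists d => // u ua.
  by apply: sd; apply: pK.
(* Local constancy makes [W P] open for every [P]; taking [P] and its negation shows that root
   number [M] is an open and closed condition in the component. *)
pose W (P : nat -> Prop) : set C^o := [set s | far s /\ P (nroots (q s) a)].
have openW P : open (W P).
  rewrite openE => t [tf Pt]; have [e e0 te] := near_s t tf.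
  apply/nbhs_ballP; exists e%:C; first by rewrite /= ltcR.
  move=> t'; rewrite -ball_normE /= normE ltcR => /te[tf' nt'].
  by split=> //; rewrite nt'.
have AW : A `&` W (eq^~ M) = A.
  apply: (component_connected (A := ~` K) (x := r)).
  - by exists s; split=> //; have [sf sM] := large s sB.
  - by exists (W (eq^~ M)).
  exists (~` W (fun k => k <> M)); first exact/open_closedC.
  apply/seteqP; split=> t [At].
    by move=> [tf tM]; split=> // -[].
  move=> nW; split=> //; split; first exact: AK.
  by apply: contrapT => tM; apply: nW; split=> //; exact: AK.
have Ar : A r.
  have nKr : (~` K) r.
    move=> Kr; have A0 : A = set0 by apply: connected_component_out; apply.
    by move: As; rewrite A0.
  exact: connected_component_refl.
have : (A `&` W (eq^~ M)) r by rewrite AW.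
by move=> [_ [_]]; rewrite /q subrr mul0r addr0.
Qed.

End UnboundedComponent.

(** * Laurent polynomials, their slices and their zeros *)

Section LaurentEvaluation.
Variable R : realType.
Local Notation C := R[i].
Implicit Types (P Q : laurent2 R) (f : laurent1 R) (x y u : C) (a b : R).

Lemma eval2_const_sub (r : C) Q x y :
  eval2 (const_sub r Q) x y = r - eval2 Q x y.
Proof.
rewrite /eval2; set A := ((0, 0) |` finsupp Q)%fset.
rewrite (@big_fset_incl _ _ _ _ _ A); last first.
- by move=> k _; rewrite memNfinsupp => /eqP ->; rewrite !mul0r.
- by apply/fsubsetP => k; rewrite mem_finsupp fsfunE; case: ifP; rewrite ?eqxx.
rewrite (@big_fset_incl _ _ _ _ (finsupp Q) A); last first.
- by move=> k _; rewrite memNfinsupp => /eqP ->; rewrite !mul0r.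
- exact: fsubsetU1.
transitivity (\sum_(k <- A) ((if k == (0, 0) then r else 0) * x ^ k.1 * y ^ k.2
    - Q k * x ^ k.1 * y ^ k.2)).
  by apply: eq_big_seq => k kA; rewrite fsfunE kA !mulrBl.
rewrite sumrB; congr (_ - _).
rewrite (big_fsetD1 (0, 0)) ?fset1U1 //= big1_fset ?addr0 ?expr0z ?mulr1 //.
by move=> k; rewrite !inE => /andP[/negbTE ->] _ _; rewrite !mul0r.
Qed.

Definition eval1 f x : C := \sum_(j <- finsupp f) f j * x ^ j.

(** Common form of [slice1] and [slice2]: with [g] a projection, [f] groups the monomials in two
    variables by one exponent. *)
Lemma eval1_fsfun (I : choiceType) (S : {fset I}) (g : I -> int) (F : I -> C)
    (x : C) (f : laurent1 R) :
  f = [fsfun i in [fset g k | k in S]%fset => \sum_(k <- S | g k == i) F k] ->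
  eval1 f x = \sum_(k <- S) F k * x ^ g k.
Proof.
move=> ->; rewrite /eval1; set A := [fset g k | k in S]%fset.
rewrite (@big_fset_incl _ _ _ _ _ A); last first.
- by move=> k _; rewrite memNfinsupp => /eqP ->; rewrite mul0r.
- by apply/fsubsetP => k; rewrite mem_finsupp fsfunE; case: ifP; rewrite ?eqxx.
transitivity (\sum_(j <- A) \sum_(k <- S | g k == j) F k * x ^ g k).
  apply: eq_big_seq => j jA; rewrite fsfunE jA mulr_suml.
  by apply: eq_bigr => k /eqP ->.
rewrite (exchange_big_dep xpredT) //=; apply: eq_big_seq => k kS.
have kA : g k \in A by apply/imfsetP; exists k.
rewrite (eq_bigl (pred1 (g k))) => [|j]; last by rewrite eq_sym.
by rewrite -big_filter filter_pred1_uniq ?fset_uniq // big_seq1.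
Qed.

Lemma eval1_slice1 P x y : eval1 (slice1 P y) x = eval2 P x y.
Proof.
rewrite (eval1_fsfun x (g := fst) (F := fun k => P k * y ^ k.2) erefl).
by apply: eq_bigr => k _; rewrite mulrAC.
Qed.

Lemma eval1_slice2 P x y : eval1 (slice2 P x) y = eval2 P x y.
Proof. by rewrite (eval1_fsfun y (g := snd) (F := fun k => P k * x ^ k.1) erefl). Qed.

(** The exponents in [clear_pole] are nonnegative, so the [absz] there changes nothing. *)
Lemma pole_orderP f (j : int) : j \in finsupp f ->
  j + (pole_order f)%:Z = (absz (j + (pole_order f)%:Z))%:Z.
Proof.
move=> jf; have : (absz (Num.min j 0) <= pole_order f)%N.
  by rewrite /pole_order (big_rem j) //= leq_maxl.
by case: (leP j 0) => hj; lia.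
Qed.

Lemma horner_clear_pole f x : x != 0 ->
  (clear_pole f).[x] = x ^+ pole_order f * eval1 f x.
Proof.
move=> x0; rewrite /clear_pole /eval1 horner_sum mulr_sumr.
apply: eq_big_seq => j jf; rewrite hornerZ hornerXn mulrCA; congr (_ * _).
by rewrite exprnP -pole_orderP // addrC expfzDr.
Qed.

(** A positive maximum in [pole_order] is attained at some exponent [j = - m], whose nonzero
    coefficient becomes the constant term. *)
Lemma clear_pole0_neq0 f : (0 < pole_order f)%N -> (clear_pole f).[0] != 0.
Proof.
move=> m0; pose m := pole_order f.
have [j jf jm] : exists2 j, j \in finsupp f & m = absz (Num.min j 0).
  have [m0'|[j [jf jm]]] :
      m = 0%N \/ exists j, j \in enum_fset (finsupp f) /\ m = absz (Num.min j 0).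
  - rewrite /m /pole_order; elim: (enum_fset (finsupp f)) => [|k s ih].
      by left; rewrite big_nil.
    rewrite big_cons; set M := (\max_(j <- s) _)%N in ih *.
    have [Mk|kM] := leqP M (absz (Num.min k 0)).
      by right; exists k; rewrite mem_head.
    case: ih => [M0|[j [js Mj]]]; first by rewrite M0 in kM.
    by right; exists j; rewrite inE js orbT.
  - by move: m0; rewrite -/m m0'.
  by exists j.
have {jm} jm : j = - m%:Z by move: jm m0; rewrite -/m; case: (leP j 0) => h; lia.
rewrite /clear_pole horner_sum (big_fsetD1 j) //= big1_fset => [|i].
  by rewrite hornerZ hornerXn jm addNr expr0 mulr1 addr0 -jm -mem_finsupp.
rewrite !inE => /andP[ij fi] _; rewrite hornerZ hornerXn -/m.
suff /negbTE ne0 : absz (i + m%:Z) != 0%N by rewrite expr0n ne0 mulr0.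
by apply: contra ij => /eqP h; apply/eqP; lia.
Qed.

Lemma mup_poly_roots (p : {poly C}) (z : C) : p != 0 ->
  mup z p = count_mem z (poly_roots p).
Proof.
move=> p0; rewrite {1}(poly_rootsE p) -mul_polyC mupMr ?mu_prod_XsubC //.
by rewrite rootC lead_coef_eq0.
Qed.

(** Only the root 0 separates [nroots] from [zeros_in_disc]. If the pole order is positive, 0 is not
    a root; if it is zero, the hypothesis leaves no root in the disc. *)
Lemma nu_eq0 f a : 0 < a -> clear_pole f != 0 ->
  nroots (clear_pole f) a = pole_order f -> nu f a = 0.
Proof.
move=> a0; set p := clear_pole f => p0 pM; rewrite /nu /zeros_in_disc -/p.
pose D := [pred z : C | 0 < `|z| < a%:C].
have -> : (\sum_(z \in [set z : C | (0 < `|z| < a%:C)%R]) mup z p)%N =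
          count D (poly_roots p).
  (* Off the roots [mup] is 0, so the sum over the disc is a finite sum over the distinct roots. *)
  rewrite -[LHS](@bigfs _ _ _ _ (undup (poly_roots p)) D).
  - rewrite -sum1_count -[RHS]big_undup_iterop_count /=; apply: eq_bigr => z _.
    by rewrite Monoid.iteropE iter_addn addn0 mul1n mup_poly_roots.
  - exact: undup_uniq.
  move=> z _; rewrite mem_undup => zs; rewrite mup_poly_roots //.
  exact/count_memPn.
have DE z : D z = (z != 0) && (cabs z < a) by rewrite /= normr_gt0 normE ltcR.
suff -> : count D (poly_roots p) = nroots p a by rewrite pM subrr.
have [m0|m0] := posnP (pole_order f).
  rewrite pM m0; apply/eqP; rewrite -leqn0 -m0 -pM sub_count // => z.
  by rewrite DE => /andP[].
apply: eq_in_count => z zs; rewrite DE.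
suff -> : z != 0 by [].
apply: contraTneq zs => ->; rewrite mem_poly_roots //.
exact: clear_pole0_neq0.
Qed.

End LaurentEvaluation.

(** * A Laurent polynomial and its logarithm on a torus, as functions of two angles *)

Section Torus.
Variable R : realType.
Local Notation C := R[i].
Implicit Types (P Q : laurent2 R) (x y u : C) (a b s t : R).

Definition torus_eval P a b s t : C := eval2 P (circle_point a s) (circle_point b t).

Lemma eval2_monomial (c : C) a b s t (k : int * int) :
  c * circle_point a s ^ k.1 * circle_point b t ^ k.2 =
  c * (a ^ k.1 * b ^ k.2)%:C * cis (k.1%:~R * s + k.2%:~R * t).
Proof.
rewrite !circle_pointE !expfzMl.
have -> : (a ^ k.1 * b ^ k.2)%:C = a%:C ^ k.1 * b%:C ^ k.2.
  by rewrite rmorphM; congr (_ * _); exact: (fmorphXz (real_complex R)).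
by rewrite !cisXz cisD -mulrA mulrACA !mulrA.
Qed.

Lemma torus_evalE P a b s t : torus_eval P a b s t =
  \sum_(k <- finsupp P) P k * (a ^ k.1 * b ^ k.2)%:C
                        * cis (k.1%:~R * s + k.2%:~R * t).
Proof. by apply: eq_bigr => k _; rewrite eval2_monomial. Qed.

Definition lip2 (G : R -> R -> R) L :=
  forall s t s' t', `|G s t - G s' t'| <= L * (`|s - s'| + `|t - t'|).

Lemma torus_eval_lip P a b : exists2 L, 0 <= L & forall s t s' t',
  cabs (torus_eval P a b s t - torus_eval P a b s' t') <=
  L * (`|s - s'| + `|t - t'|).
Proof.
pose l (k : int * int) := cabs (P k * (a ^ k.1 * b ^ k.2)%:C) *
  (2 * (`|k.1%:~R| + `|k.2%:~R|)) : R.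
exists (\sum_(k <- finsupp P) l k).
  by rewrite sumr_ge0 // => k _; rewrite mulr_ge0 ?cabs_ge0 // mulr_ge0 ?addr_ge0.
move=> s t s' t'; rewrite !torus_evalE -sumrB (le_trans (ler_cabs_sum _ _)) //.
rewrite mulr_suml ler_sum // => k _; rewrite -mulrBr cabsM /l -mulrA.
rewrite ler_wpM2l ?cabs_ge0 // (le_trans (dist_cis_le _ _)) // -mulrA ler_pM2l //.
have -> : k.1%:~R * s + k.2%:~R * t - (k.1%:~R * s' + k.2%:~R * t') =
  k.1%:~R * (s - s') + k.2%:~R * (t - t') :> R by ring.
rewrite (le_trans (ler_normD _ _)) // !normrM.
have := normr_ge0 (s - s'); have := normr_ge0 (t - t').
have := normr_ge0 (k.1%:~R : R); have := normr_ge0 (k.2%:~R : R); nra.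
Qed.

Lemma lip2_continuous G L : lip2 G L -> continuous (fun p : R * R => G p.1 p.2).
Proof.
move=> GL [s t]; have [L0|L0] := leP L 0.
  apply/cvgrPdist_le => e e0; apply: nearW => -[s' t'] /=.
  rewrite (le_trans (GL _ _ _ _)) // (le_trans _ (ltW e0)) //.
  by rewrite mulr_le0_ge0 // addr_ge0.
apply/cvgrPdist_le => e e0; have d0 : 0 < e / (2 * L) by rewrite divr_gt0 ?mulr_gt0.
exists (ball s (e / (2 * L)), ball t (e / (2 * L))); first by split; exact: nbhsx_ballx.
move=> [s' t'] [/= ss tt]; rewrite (le_trans (GL _ _ _ _)) //.
move: ss tt; rewrite -!ball_normE /= => ss tt.
have -> : e = L * (e / (2 * L) + e / (2 * L)) by field; rewrite gt_eqF.
by rewrite ler_pM2l // lerD // ltW.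
Qed.

Lemma circle_cabs a t : 0 < a -> cabs (circle_point a t) = a.
Proof. by move=> a0; rewrite circle_pointE cabsM cabsR cabs_cis mulr1 gtr0_norm. Qed.

Lemma torus_imageP Q a b z : torus_image Q a b z <->
  exists x y, [/\ cabs x = a, cabs y = b & z = eval2 Q x y].
Proof.
by split=> -[x [y [xa yb ->]]]; exists x, y; split=> //;
  [apply: (@complexI R); rewrite -normE..|rewrite normE xa|rewrite normE yb].
Qed.

(** The distance to [r] is a Lipschitz function of the angles, so it attains its minimum on the
    closed square of angles; the minimum is positive because [r] is not a value. *)
Lemma torus_image_separated Q a b (r : C) : 0 < a -> 0 < b ->
  ~ torus_image Q a b r ->
  exists2 d, 0 < d & forall w, torus_image Q a b w -> d <= cabs (r - w).
Proof.
move=> a0 b0 nr; have [L L0 EL] := torus_eval_lip Q a b.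
pose G s t := cabs (r - torus_eval Q a b s t).
have GL : lip2 G L.
  move=> s t s' t'; rewrite (le_trans (ler_dist_cabs _ _)) //.
  by rewrite (le_trans _ (EL s t s' t')) // cabsBC opprB addrC subrKA.
have [[s t] _ stm] : exists2 c : R * R, c \in `[0, 2 * pi]%classic `*` `[0, 2 * pi]%classic &
    forall c', c' \in `[0, 2 * pi]%classic `*` `[0, 2 * pi]%classic -> G c.1 c.2 <= G c'.1 c'.2.
  apply: compact_EVT_min.
  - by exists (0, 0); split=> /=; rewrite in_itv /= lexx mulr_ge0 ?pi_ge0.
  - by apply: compact_setX; exact: segment_compact.
  exact/continuous_subspaceT/(lip2_continuous GL).
exists (G s t).
  rewrite cabs_gt0 subr_eq0; apply/eqP => rE; apply: nr; apply/torus_imageP.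
  by exists (circle_point a s), (circle_point b t); rewrite !circle_cabs.
move=> w /torus_imageP[x [y [xa yb ->]]].
have [s' s'I ->] := polar x; have [t' t'I ->] := polar y.
rewrite xa yb; apply: (stm (s', t')).
by rewrite inE; split; rewrite /= in_itv.
Qed.

Lemma ln_lip (d x y : R) : 0 < d -> d <= x -> d <= y ->
  `|ln x - ln y| <= `|x - y| / d.
Proof.
wlog xy : x y / y <= x.
  move=> H d0 dx dy; case: (leP y x) => [/H|/ltW/H]; first exact.
  by rewrite distrC (distrC x); exact.
move=> d0 dx dy; have y0 := lt_le_trans d0 dy; have x0 := lt_le_trans d0 dx.
rewrite !ger0_norm ?subr_ge0 // ?ler_ln ?posrE // -ln_div ?posrE //.
(* Then [ln (1 + h) <= h] applies with [h = (x - y) / y], where [y >= d]. *)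
have -> : x / y = 1 + (x - y) / y by field; rewrite gt_eqF.
rewrite (le_trans (le_ln1Dx _)) //.
  by rewrite (lt_le_trans (ltrN10 _)) // divr_ge0 ?subr_ge0 // ltW.
by rewrite ler_wpM2l ?subr_ge0 // lef_pV2 ?posrE.
Qed.

Lemma ln_torus_lip P a b d : 0 < d ->
  (forall s t, d <= cabs (torus_eval P a b s t)) ->
  exists2 L, 0 <= L & lip2 (fun s t => ln (cabs (torus_eval P a b s t))) L.
Proof.
move=> d0 dP; have [L L0 EL] := torus_eval_lip P a b.
exists (L / d); first by rewrite divr_ge0 // ltW.
move=> s t s' t'; rewrite (le_trans (ln_lip d0 _ _)) // mulrAC.
rewrite ler_pM2r ?invr_gt0 //.
exact: le_trans (ler_dist_cabs _ _) (EL _ _ _ _).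
Qed.

Local Notation TR := (measurableTypeR R).

(** [riemann2] asks for measurability on the product space; it comes from the real and imaginary
    parts, finite sums of sines and cosines of linear forms. *)
Lemma measurable_ln_torus P a b :
  measurable_fun setT (fun p : TR * TR => ln (cabs (torus_eval P a b p.1 p.2))).
Proof.
have mlin (k : int * int) : measurable_fun setT
    (fun p : TR * TR => k.1%:~R * p.1 + k.2%:~R * p.2 : R).
  by apply: measurable_funD; apply: measurable_funM.
have mcos k : measurable_fun setT (fun p : TR * TR => cos (k.1%:~R * p.1 + k.2%:~R * p.2)).
  apply: (measurableT_comp (f := cos)) (mlin k).
  by apply: continuous_measurable_fun; exact: continuous_cos.
have msin k : measurable_fun setT (fun p : TR * TR => sin (k.1%:~R * p.1 + k.2%:~R * p.2)).
  apply: (measurableT_comp (f := sin)) (mlin k).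
  by apply: continuous_measurable_fun; exact: continuous_sin.
pose c k := P k * (a ^ k.1 * b ^ k.2)%:C.
have mRe : measurable_fun setT (fun p : TR * TR => complex.Re (torus_eval P a b p.1 p.2)).
  rewrite (_ : (fun p => _) = fun p : TR * TR => \sum_(k <- finsupp P)
     (complex.Re (c k) * cos (k.1%:~R * p.1 + k.2%:~R * p.2) -
      complex.Im (c k) * sin (k.1%:~R * p.1 + k.2%:~R * p.2))).
    apply: measurable_sum => k.
    by apply: measurable_funB; apply: measurable_funM.
  apply/funext => p; rewrite torus_evalE raddf_sum; apply: eq_bigr => k _.
  by rewrite /c; case: (P k * _) => u v; rewrite /cis; simpc.
have mIm : measurable_fun setT (fun p : TR * TR => complex.Im (torus_eval P a b p.1 p.2)).
  rewrite (_ : (fun p => _) = fun p : TR * TR => \sum_(k <- finsupp P)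
     (complex.Re (c k) * sin (k.1%:~R * p.1 + k.2%:~R * p.2) +
      complex.Im (c k) * cos (k.1%:~R * p.1 + k.2%:~R * p.2))).
    apply: measurable_sum => k.
    by apply: measurable_funD; apply: measurable_funM.
  apply/funext => p; rewrite torus_evalE raddf_sum; apply: eq_bigr => k _.
  by rewrite /c; case: (P k * _) => u v; rewrite /cis; simpc.
have msqrt : measurable_fun setT (@Num.sqrt R).
  by apply: continuous_measurable_fun; exact: sqrt_continuous.
apply: (measurableT_comp (@measurable_ln R)).
rewrite (_ : (fun p => _) = fun p : TR * TR => Num.sqrt
  (complex.Re (torus_eval P a b p.1 p.2) ^+ 2 + complex.Im (torus_eval P a b p.1 p.2) ^+ 2)).
  apply: (measurableT_comp msqrt).
  by apply: measurable_funD; apply: measurable_funX.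
by apply/funext => p; rewrite cabsE.
Qed.

End Torus.

(** * Riemann sums with explicit error, in one and two variables *)

Section RiemannSums.
Variable R : realType.
Local Notation mu := (@lebesgue_measure R).
Implicit Types (f : R -> R) (G : R -> R -> R).

Lemma continuous_itv_integrable f (c d : R) : continuous f ->
  mu.-integrable `[c, d] (EFin \o f).
Proof.
move=> cf; apply: continuous_compact_integrable; first exact: segment_compact.
exact: continuous_subspaceT.
Qed.

Lemma measure_segment (c d : R) : c <= d -> mu `[c, d]%classic = (d - c)%:E.
Proof.
move=> cd; rewrite lebesgue_measure_itv /= lte_fin -EFinB; case: ltP => // dc.
by rewrite (le_anti (introT andP (conj cd dc))) subrr.
Qed.

Lemma Rintegral_dist_cst f (c d e v : R) : continuous f -> c <= d ->
  (forall x, c <= x <= d -> `|f x - v| <= e) ->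
  `|\int[mu]_(x in `[c, d]) f x - (d - c) * v| <= (d - c) * e.
Proof.
move=> cf cd fe.
have muE := measure_segment cd.
have cst (w : R) : \int[mu]_(x in `[c, d]) w = (d - c) * w.
  by rewrite Rintegral_cst // mulrC; congr (_ * _); exact: (congr1 fine muE).
have icst (w : R) : mu.-integrable `[c, d] (EFin \o (fun=> w)).
  by apply: continuous_itv_integrable => x; exact: cst_continuous.
have iF := continuous_itv_integrable c d cf.
have iB : mu.-integrable `[c, d] (EFin \o (fun x => f x - v)).
  by apply: continuous_itv_integrable => x; apply: continuousB; [exact: cf|exact: cst_continuous].
rewrite -(cst v) -(cst e) -RintegralB //.
rewrite (le_trans (le_normr_Rintegral _ _)) //.
by apply: le_Rintegral => //; exact: integrable_norm iB.
Qed.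

(** Induction on the number of cells, with left endpoints as sample points; [e] bounds the
    oscillation of [f] on one cell. *)
Lemma riemann1 f (h e : R) (n : nat) : continuous f -> 0 <= h ->
  (forall x y, `|x - y| <= h -> `|f x - f y| <= e) ->
  `|\int[mu]_(x in `[0, n%:R * h]) f x - h * \sum_(k < n) f (k%:R * h)| <=
    n%:R * h * e.
Proof.
move=> cf h0 fe; elim: n => [|n ih].
  by rewrite mul0r big_ord0 mulr0 subr0 set_itv1 Rintegral_set1 normr0 mul0r.
have nh : n%:R * h <= n.+1%:R * h by rewrite ler_wpM2r // ler_nat.
have n0 : 0 <= n%:R * h by rewrite mulr_ge0.
have iF := continuous_itv_integrable 0 (n.+1%:R * h) cf.
have := @Rintegral_itvB R f (BLeft 0) (BRight (n.+1%:R * h)) (n%:R * h) iF.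
rewrite !bnd_simp => /(_ n0 nh).
rewrite Rintegral_itv_obnd_cbnd; last first.
  apply: (integrableS _ _ _ (continuous_itv_integrable (n%:R * h) (n.+1%:R * h) cf)) => //.
  exact: subset_itv_oc_cc.
move/eqP; rewrite subr_eq => /eqP ->; rewrite big_ord_recr /= mulrDr.
have hE : n.+1%:R * h - n%:R * h = h by rewrite -mulrBl -natrB // subSnn mul1r.
have last_cell : `|\int[mu]_(x in `[n%:R * h, n.+1%:R * h]) f x - h * f (n%:R * h)| <= h * e.
  rewrite -[X in X * f _]hE -[X in X * e]hE; apply: Rintegral_dist_cst => //.
  move=> x /andP[x1 x2]; apply: fe.
  by rewrite ger0_norm ?subr_ge0 // -[leRHS]hE lerD2r.
have dE (x y z t : R) : x + y - (z + t) = (y - z) + (x - t) by ring.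
rewrite dE (le_trans (ler_normD _ _)) //.
have -> : n.+1%:R * h * e = n%:R * h * e + h * e by rewrite -natr1; ring.
exact: lerD.
Qed.

Lemma lip1_continuous f L : (forall x y, `|f x - f y| <= L * `|x - y|) -> continuous f.
Proof.
move=> fL x; apply/cvgrPdist_le => e e0.
have M0 : 0 < `|L| + 1 by rewrite ltr_wpDl.
exists (e / (`|L| + 1)); first by rewrite /= divr_gt0.
move=> y /= xy; rewrite (le_trans (fL _ _)) //.
rewrite (@le_trans _ _ ((`|L| + 1) * `|x - y|)) //.
  by rewrite ler_wpM2r // (le_trans (ler_norm _)) // lerDl.
by rewrite mulrC -ler_pdivlMr // ltW.
Qed.

(** [V] is the iterated integral. Replacing the outer and then the inner integral by a sum costs
    [w * (w L h)] each time, whence the factor 2. *)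
Lemma riemann2 G (L w : R) : 0 <= w -> 0 <= L -> lip2 G L ->
  measurable_fun setT (fun p : measurableTypeR R * measurableTypeR R => G p.1 p.2) ->
  exists2 V : R,
    (\int[(mu \x mu)%E]_(p in `[0%R, w] `*` `[0%R, w]) (G p.1 p.2)%:E = V%:E)%E &
    forall (n : nat) (h : R), 0 <= h -> w = n%:R * h ->
     `|V - h ^+ 2 * \sum_(j < n) \sum_(k < n) G (j%:R * h) (k%:R * h)|
       <= 2 * w ^+ 2 * L * h.
Proof.
move=> w0 L0 GL mG; pose I := `[0%R, w]%classic : set R.
have mI : measurable (I : set (measurableTypeR R)) by exact: measurable_itv.
have cG s : continuous (G s).
  apply: (@lip1_continuous _ L) => x y; rewrite (le_trans (GL _ _ _ _)) //.
  by rewrite subrr normr0 add0r.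
pose J s := \int[mu]_(t in I) G s t.
have JL s s' : `|J s - J s'| <= (w * L) * `|s - s'|.
  have iG r : mu.-integrable I (EFin \o G r) by exact: continuous_itv_integrable.
  rewrite /J -(RintegralB mI (iG s) (iG s')) -mulrA.
  have := @Rintegral_dist_cst (fun t => G s t - G s' t) 0 w (L * `|s - s'|) 0.
  rewrite mulr0 !subr0; apply => //.
    by move=> x; apply: continuousB; exact: cG.
  by move=> x _; rewrite subr0 (le_trans (GL _ _ _ _)) // subrr normr0 addr0.
have cJ : continuous J by apply: lip1_continuous JL.
exists (\int[mu]_(s in I) J s).
  have mII : measurable (I `*` I : set (measurableTypeR R * measurableTypeR R)).
    exact: measurableX.
  (* Integrability for Fubini: [G] is bounded on a square of finite measure. *)
  have iII : (mu \x mu)%E.-integrable (I `*` I)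
      (EFin \o (fun p : measurableTypeR R * measurableTypeR R => G p.1 p.2)).
    apply: measurable_bounded_integrable => //.
    - rewrite /= product_measure1E // (_ : (_ * _)%E = ((w - 0) * (w - 0))%:E) ?ltry //.
      by rewrite EFinM; congr (_ * _)%E; exact: measure_segment.
    - exact: measurable_funTS.
    exists (`|G 0 0| + L * (w + w)); split; first exact: num_real.
    move=> M hM [s t] []; rewrite /I /= !in_itv /= => /andP[s0 s1] /andP[t0 t1].
    rewrite (le_trans _ (ltW hM)) // -lerBlDl (le_trans (lerB_dist _ _)) //.
    rewrite (le_trans (GL _ _ _ _)) // ler_wpM2l // !subr0 !ger0_norm //.
    by rewrite lerD.
  rewrite integral_mkcond /= -integral12_prod_meas1; last first.
    exact: (integrable_mkcond _ mII).1 iII.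
  transitivity (\int[mu]_(s in I) (J s)%:E)%E; last first.
    by rewrite /Rintegral fineK // integrable_fin_num //; exact: continuous_itv_integrable.
  rewrite [RHS]integral_mkcond; apply: eq_integral => s _.
  rewrite /fubini_F /patch; case: ifPn => sI.
    rewrite /J /Rintegral fineK; last first.
      by rewrite integrable_fin_num //; exact: continuous_itv_integrable.
    rewrite [RHS]integral_mkcond; apply: eq_integral => t _.
    by rewrite /patch in_setX /= sI.
  rewrite integral0_eq // => t _.
  by rewrite in_setX /= (negbTE sI).
move=> n h h0 wE.
have S1 : `|\int[mu]_(s in I) J s - h * \sum_(j < n) J (j%:R * h)| <= w * (w * L * h).
  have := @riemann1 J h (w * L * h) n cJ h0; rewrite -wE; apply=> x y xy.
  by rewrite (le_trans (JL _ _)) // ler_wpM2l // mulr_ge0.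
have S2 s : `|J s - h * \sum_(k < n) G s (k%:R * h)| <= w * (L * h).
  have := @riemann1 (G s) h (L * h) n (cG s) h0; rewrite -wE; apply=> x y xy.
  by rewrite (le_trans (GL _ _ _ _)) // subrr normr0 add0r ler_wpM2l.
have S3 : `|h * \sum_(j < n) J (j%:R * h) -
    h ^+ 2 * \sum_(j < n) \sum_(k < n) G (j%:R * h) (k%:R * h)| <= w * (w * (L * h)).
  rewrite expr2 -mulrA -mulrBr mulr_sumr -sumrB normrM ger0_norm // [in leRHS]wE.
  rewrite [n%:R * h]mulrC -[leRHS]mulrA ler_wpM2l // (le_trans (ler_norm_sum _ _ _)) //.
  have -> : n%:R * (h * n%:R * (L * h)) = \sum_(j < n) (w * (L * h)).
    by rewrite sumr_const card_ord mulr_natl wE [h * _]mulrC.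
  by rewrite ler_sum.
have := lerD S1 S3; move/(le_trans (ler_normD _ _)); rewrite subrKA => /le_trans; apply.
rewrite [leRHS](_ : _ = w * (w * L * h) + w * (w * (L * h))) //; ring.
Qed.

End RiemannSums.

(** * Jensen's formula as an inequality over roots of unity, and restriction to curves *)

Section DiscreteJensen.
Variable R : realType.
Local Notation C := R[i].
Implicit Types (P Q : laurent2 R) (p : {poly C}) (x y z u : C) (a b rho theta : R).

Lemma prod_cabs_prim_root n (w : C) rho z : n.-primitive_root w -> 0 < rho ->
  \prod_(l < n) cabs (rho%:C * w ^+ l - z) = cabs ((rho ^+ n)%:C - z ^+ n).
Proof.
move=> pw r0; have rC : rho%:C != 0 by rewrite -cabs_gt0 cabsR normr_gt0 gt_eqF.
have := congr1 (fun q : {poly C} => q.[z / rho%:C]) (factor_Xn_sub_1 pw).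
rewrite big_mkord horner_prod !hornerE ?hornerXn => E.
rewrite -cabs_prod; have -> : \prod_(l < n) (rho%:C * w ^+ l - z) =
    (- rho%:C) ^+ n * \prod_(l < n) (z / rho%:C - w ^+ l).
  have -> : (- rho%:C) ^+ n = \prod_(l < n) (- rho%:C) by rewrite prodr_const card_ord.
  rewrite -big_split /=.
  by apply: eq_bigr => l _; field.
under [X in _ * X]eq_bigr => l _ do rewrite -hornerXsubC.
rewrite E exprNn -mulrA cabsM cabsX cabsN cabs1 expr1n mul1r.
rewrite mulrBr mulr1 expr_div_n mulrCA divff ?expf_neq0 // mulr1 cabsBC.
by rewrite rmorphXn.
Qed.

(** The supporting line inequality [ln (max 1 |z|) + [|z| < 1] ln rho <= ln (max rho |z|)],
    multiplied by [n] and exponentiated. The gap bounds both [rho^n] and [|z|^n] by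
    [2 |rho^n - z^n|]; the other factor 2 comes from [|1 - z^n| <= 2 max (1, |z|^n)]. *)
Lemma root_ratio_le rho theta z n : 0 < rho -> 0 <= theta ->
  theta ^+ n <= 2^-1 -> cabs z <= theta * rho \/ rho <= theta * cabs z ->
  (if cabs z < 1 then rho ^+ n else 1) * cabs (1 - z ^+ n) <=
  4 * cabs ((rho ^+ n)%:C - z ^+ n).
Proof.
move=> r0 t0 tn gap; set m := cabs z; have m0 : 0 <= m := cabs_ge0 z.
have rn0 : 0 <= rho ^+ n by rewrite exprn_ge0 // ltW.
have mn0 : 0 <= m ^+ n by rewrite exprn_ge0.
have up : cabs (1 - z ^+ n) <= 1 + m ^+ n.
  by rewrite (le_trans (ler_cabsBD _ _)) // cabs1 cabsX.
have rC : cabs (rho ^+ n)%:C = rho ^+ n by rewrite cabsR ger0_norm.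
have t1 k : theta ^+ n * k ^+ n = (theta * k) ^+ n by rewrite exprMn.
have [lo1 lo2] : rho ^+ n <= 2 * cabs ((rho ^+ n)%:C - z ^+ n) /\
    m ^+ n <= 2 * cabs ((rho ^+ n)%:C - z ^+ n).
  case: gap => gap.
    have h : m ^+ n <= theta ^+ n * rho ^+ n.
      by rewrite t1 lerXn2r ?nnegrE // mulr_ge0 // ltW.
    have := ler_cabsB ((rho ^+ n)%:C) (z ^+ n); rewrite rC cabsX -/m; nra.
  have h : rho ^+ n <= theta ^+ n * m ^+ n.
    by rewrite t1 lerXn2r ?nnegrE ?mulr_ge0 // ltW.
  have := ler_cabsB (z ^+ n) ((rho ^+ n)%:C).
  by rewrite rC cabsX -/m cabsBC; nra.
case: (ltP m 1) => hm.
  have : m ^+ n <= 1 by rewrite exprn_ile1 // ltW.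
  nra.
have : 1 <= m ^+ n by rewrite exprn_ege1.
lra.
Qed.

Lemma prod_horner_cabs p n (w : C) rho : n.-primitive_root w -> 0 < rho ->
  \prod_(l < n) cabs p.[rho%:C * w ^+ l] =
  cabs (lead_coef p) ^+ n *
    \prod_(z <- poly_roots p) cabs ((rho ^+ n)%:C - z ^+ n).
Proof.
move=> pw r0.
transitivity (\prod_(l < n) (cabs (lead_coef p) *
    \prod_(z <- poly_roots p) cabs (rho%:C * w ^+ l - z))).
  apply: eq_bigr => l _; rewrite {1}(poly_rootsE p) hornerZ cabsM horner_prod.
  by rewrite cabs_prod; congr (_ * _); apply: eq_bigr => z _; rewrite hornerXsubC.
rewrite big_split /= prodr_const card_ord exchange_big /=; congr (_ * _).
by apply: eq_bigr => z _; rewrite prod_cabs_prim_root.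
Qed.

(** The product of [root_ratio_le] over all roots; the leading coefficient has the same power on
    both sides. *)
Lemma jensen_prod p n (w : C) rho theta : n.-primitive_root w ->
  0 < rho -> 0 <= theta -> theta ^+ n <= 2^-1 ->
  {in poly_roots p, forall z, cabs z <= theta * rho \/ rho <= theta * cabs z} ->
  (rho ^+ n) ^+ nroots p 1 * \prod_(l < n) cabs p.[w ^+ l] <=
  4 ^+ size (poly_roots p) * \prod_(l < n) cabs p.[rho%:C * w ^+ l].
Proof.
move=> pw r0 t0 tn gap.
have -> : \prod_(l < n) cabs p.[w ^+ l] = \prod_(l < n) cabs p.[1%:C * w ^+ l].
  by apply: eq_bigr => l _; rewrite mul1r.
rewrite !prod_horner_cabs // !(mulrCA _ (cabs _ ^+ n)).
rewrite ler_wpM2l ?exprn_ge0 ?cabs_ge0 // /nroots.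
elim: (poly_roots p) gap => [|z s ih] gap; first by rewrite !big_nil !mulr1.
have {}ih : (rho ^+ n) ^+ count (fun z => cabs z < 1) s *
    \prod_(j <- s) cabs ((1 ^+ n)%:C - j ^+ n)
  <= 4 ^+ size s * \prod_(j <- s) cabs ((rho ^+ n)%:C - j ^+ n).
  by apply: ih => j js; apply: gap; rewrite inE js orbT.
rewrite !big_cons /= exprD exprS mulrACA [leRHS]mulrACA.
have pos (c : R) : 0 <= \prod_(j <- s) cabs (c%:C - j ^+ n).
  by rewrite prodr_ge0 // => j _; exact: cabs_ge0.
rewrite ler_pM //.
- by rewrite mulr_ge0 ?cabs_ge0 // exprn_ge0 // exprn_ge0 // ltW.
- by rewrite mulr_ge0 // exprn_ge0 // exprn_ge0 // ltW.
have := root_ratio_le r0 t0 tn (gap z (mem_head _ _)).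
by rewrite expr1n; case: ifP; rewrite ?expr1 ?expr0.
Qed.

(** The exponents of [P (x u^v, y u^w)] in [u] lie between [-M] and [M] for this [M], whatever [x]
    and [y] are, so degrees are bounded uniformly over the grid. Overshooting the pole order is
    harmless: the extra roots are at 0, where [nroots] counts them. *)
Definition line_order P (v w : int) : nat :=
  \max_(k <- finsupp P) absz (v * k.1 + w * k.2)%R.

Definition line_poly P (v w : int) x y : {poly C} :=
  \sum_(k <- finsupp P) (P k * x ^ k.1 * y ^ k.2) *:
     'X^(absz ((line_order P v w)%:Z + (v * k.1 + w * k.2))).

Lemma line_orderP P v w (k : int * int) : k \in finsupp P ->
  (absz (v * k.1 + w * k.2)%R <= line_order P v w)%N.
Proof.
move=> kP; rewrite /line_order (big_rem k) //=; exact: leq_maxl.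
Qed.

Lemma horner_line_poly P v w x y u : u != 0 ->
  (line_poly P v w x y).[u] =
  u ^+ line_order P v w * eval2 P (x * u ^ v) (y * u ^ w).
Proof.
move=> u0; rewrite /line_poly /eval2 horner_sum mulr_sumr.
apply: eq_big_seq => k kP; rewrite hornerZ hornerXn.
have := line_orderP v w kP; set m := line_order P v w => km.
have e : (absz (m%:Z + (v * k.1 + w * k.2)))%:Z = m%:Z + (v * k.1 + w * k.2).
  by move: (v * k.1 + w * k.2) km => t; clearbody m; lia.
rewrite exprnP e !expfzDr // !expfzMl -!exprz_exp.
rewrite -[u ^ m%:Z]/(u ^+ m).
move: (P k) (x ^ k.1) (y ^ k.2) (u ^+ m) (u ^ v ^ k.1) (u ^ w ^ k.2).
by move=> c A B U V W; ring.
Qed.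

Lemma size_line_poly P v w x y :
  (size (line_poly P v w x y) <= (2 * line_order P v w).+1)%N.
Proof.
rewrite /line_poly big_seq; apply: (leq_trans (size_sum _ _ _)).
apply/bigmax_leqP_seq => k kP _; have := line_orderP v w kP => km.
rewrite (leq_trans (size_scale_leq _ _)) // size_polyXn.
by move: (v * k.1 + w * k.2) km => t; lia.
Qed.

Lemma sum_shift1 (g : R -> R) (h : R) n : g (n%:R * h) = g 0 ->
  \sum_(j < n) g (j.+1%:R * h) = \sum_(j < n) g (j%:R * h).
Proof.
case: n => [|n] gn; first by rewrite !big_ord0.
by rewrite big_ord_recr big_ord_recl /= gn mul0r addrC.
Qed.

(** A shift by one step permutes the sample points cyclically modulo the period [n h]; the same step
    read backwards reaches negative [c]. *)
Lemma sum_shift (g : R -> R) (h : R) n (c : int) :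
  (forall t, g (t + n%:R * h) = g t) ->
  \sum_(j < n) g (j%:R * h + c%:~R * h) = \sum_(j < n) g (j%:R * h).
Proof.
move=> per; pose F (d : int) := \sum_(j < n) g (j%:R * h + d%:~R * h).
have FS d : F (d + 1) = F d.
  rewrite /F -(@sum_shift1 (fun t => g (t + d%:~R * h))).
    apply: eq_bigr => j _; congr g.
    by rewrite intrD -natr1 !mulrDl -!addrA; congr (_ + _); rewrite addrC.
  by rewrite addrC per add0r.
have -> : \sum_(j < n) g (j%:R * h) = F 0.
  by apply: eq_bigr => j _; rewrite mul0r addr0.
rewrite -/(F c); elim/int_ind: c => [//|m ih|m ih].
  by rewrite -addn1 PoszD FS.
by rewrite -ih -[LHS]FS; congr F; lia.
Qed.
End DiscreteJensen.

(** * Comparison of grid sums on two tori, and their limits *)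

Section Ronkin.
Variable R : realType.
Local Notation C := R[i].
Implicit Types (P Q : laurent2 R) (x y z : C) (a b rho theta : R).

Definition grid_sum P a b n : R := \sum_(j < n) \sum_(k < n)
  ln (cabs (torus_eval P a b (j%:R * (2 * pi / n%:R)) (k%:R * (2 * pi / n%:R)))).

(** The angle moves by a whole number of steps [h], which keeps the curve on the grid. *)
Lemma circle_point_mulXz a rho s h (l : nat) (v : int) :
  circle_point a s * (rho%:C * cis h ^+ l) ^ v =
  circle_point (a * rho ^ v) (s + (v * l)%:~R * h).
Proof.
rewrite !circle_pointE expfzMl cisX cisXz cisD mulrACA; congr (_ * (_ * cis _)).
  by rewrite rmorphM; congr (_ * _); exact/esym/(fmorphXz (real_complex R)).
by rewrite intrM mulrA.
Qed.

Lemma circle_point_periodic a s : circle_point a (s + 2 * pi) = circle_point a s.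
Proof. by rewrite !circle_pointE cisD cis_2pi mulr1. Qed.

Lemma ln_prod n (F : 'I_n -> R) : (forall i, 0 < F i) ->
  ln (\prod_(i < n) F i) = \sum_(i < n) ln (F i).
Proof.
elim: n F => [|n ih] F F0; first by rewrite !big_ord0 ln1.
rewrite !big_ord_recr /= lnM ?posrE ?F0 //; last by rewrite prodr_gt0.
by rewrite ih.
Qed.

Lemma sum_ln_le n (F G : nat -> R) (s K : nat) :
  (forall i, 0 < F i) -> (forall i, 0 < G i) -> (s <= K)%N ->
  \prod_(i < n) F i <= 4 ^+ s * \prod_(i < n) G i ->
  \sum_(i < n) ln (F i) <= \sum_(i < n) ln (G i) + K%:R * ln 4.
Proof.
move=> F0 G0 sK le1; have FP : 0 < \prod_(i < n) F i by rewrite prodr_gt0.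
have GP : 0 < \prod_(i < n) G i by rewrite prodr_gt0.
rewrite -!ln_prod // addrC mulr_natl -lnXn // -lnM ?posrE ?exprn_gt0 //.
rewrite ler_ln ?posrE ?mulr_gt0 ?exprn_gt0 // (le_trans le1) //.
by rewrite ler_pM2r // ler_weXn2l // ler1n.
Qed.

(** The hypothesis on [nroots] is the vanishing of the gradient in the direction [(v, w)]; the last
    one is a zero-free annulus around [|z| = rho], from which the gap in [jensen_prod] follows. *)
Lemma line_sum_le P a b v w rho theta n s t h : (0 < n)%N -> h = 2 * pi / n%:R ->
  0 < a -> 0 < b -> 0 < rho -> 0 <= theta < 1 -> theta ^+ n <= 2^-1 ->
  (forall x y, cabs x = a -> cabs y = b ->
     nroots (line_poly P v w x y) 1 = line_order P v w) ->
  (forall x y, cabs x = a -> cabs y = b -> eval2 P x y != 0) ->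
  (forall x y z, cabs x = a -> cabs y = b ->
     theta * rho < cabs z -> theta * cabs z < rho ->
     eval2 P (x * z ^ v) (y * z ^ w) != 0) ->
  \sum_(l < n) ln (cabs (torus_eval P a b (s + (v * l)%:~R * h) (t + (w * l)%:~R * h))) <=
  \sum_(l < n) ln (cabs (torus_eval P (a * rho ^ v) (b * rho ^ w)
                           (s + (v * l)%:~R * h) (t + (w * l)%:~R * h))) +
  (2 * line_order P v w)%:R * ln 4.
Proof.
move=> n0 hE a0 b0 r0 /andP[t0 t1] tn nr nz gap.
pose x := circle_point a s; pose y := circle_point b t.
have xa : cabs x = a by exact: circle_cabs.
have yb : cabs y = b by exact: circle_cabs.
pose p := line_poly P v w x y; pose M := line_order P v w.
have pw : n.-primitive_root (cis h) by rewrite hE; exact: prim_root_cis.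
have ub l : cis h ^+ l != 0 by rewrite expf_neq0 // cis_neq0.
have rb l : rho%:C * cis h ^+ l != 0.
  by rewrite mulf_neq0 // -cabs_gt0 cabsR gtr0_norm.
have E1 l : cabs p.[cis h ^+ l] =
    cabs (torus_eval P a b (s + (v * l%:Z)%:~R * h) (t + (w * l%:Z)%:~R * h)).
  rewrite horner_line_poly // cabsM !cabsX cabs_cis !expr1n mul1r.
  have := circle_point_mulXz a 1 s h l v; have := circle_point_mulXz b 1 t h l w.
  by rewrite !mul1r !exp1rz !mulr1 => -> ->.
have E2 l : cabs p.[rho%:C * cis h ^+ l] = rho ^+ M *
    cabs (torus_eval P (a * rho ^ v) (b * rho ^ w)
      (s + (v * l%:Z)%:~R * h) (t + (w * l%:Z)%:~R * h)).
  rewrite horner_line_poly // cabsM cabsX cabsM cabsR cabsX cabs_cis expr1n mulr1.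
  rewrite (gtr0_norm r0); congr (_ * cabs _).
  by rewrite /torus_eval -(circle_point_mulXz a) -(circle_point_mulXz b).
have P1 l : 0 < cabs (torus_eval P a b (s + (v * l%:Z)%:~R * h) (t + (w * l%:Z)%:~R * h)).
  by rewrite cabs_gt0 nz // circle_cabs.
have P2 l : 0 < cabs (torus_eval P (a * rho ^ v) (b * rho ^ w)
      (s + (v * l%:Z)%:~R * h) (t + (w * l%:Z)%:~R * h)).
  have cl : cabs (rho%:C * cis h ^+ l) = rho.
    by rewrite cabsM cabsR cabsX cabs_cis expr1n mulr1 gtr0_norm.
  rewrite cabs_gt0 /torus_eval -(circle_point_mulXz a) -(circle_point_mulXz b).
  rewrite gap ?circle_cabs // cl.
    by rewrite gtr_pMl.
  by rewrite gtr_pMl.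
have p0 : p != 0.
  by apply: contraTneq (P1 0%N) => p0; rewrite -E1 p0 horner0 cabs0 ltxx.
have gap' : {in poly_roots p, forall z, cabs z <= theta * rho \/ rho <= theta * cabs z}.
  move=> z; rewrite mem_poly_roots // => pz.
  have [z1|z1] := leP (cabs z) (theta * rho); [by left|right].
  rewrite leNgt; apply/negP => z2; have z0 : z != 0.
    by rewrite -cabs_gt0 (le_lt_trans _ z1) // mulr_ge0 // ltW.
  move: pz; rewrite horner_line_poly // mulf_eq0 expf_eq0 (negbTE z0) andbF /=.
  by apply/negP; exact: gap.
have := jensen_prod pw r0 t0 tn gap'; rewrite nr //.
under eq_bigr => l _ do rewrite E1.
under [X in _ <= _ * X]eq_bigr => l _ do rewrite E2.
(* The power of [rho] contributed by the [M] roots in the unit disc cancels the factor [rho^M] that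
   [line_poly] carries at each of the [n] points. *)
rewrite [X in _ <= _ * X]big_split /= prodr_const card_ord exprAC mulrCA.
rewrite ler_pM2l ?exprn_gt0 // -/M => le1.
apply: (sum_ln_le P1 P2 _ le1).
by rewrite -ltnS -size_poly_roots // size_line_poly.
Qed.

Lemma grid_sum_le P a b v w rho theta n : (0 < n)%N ->
  0 < a -> 0 < b -> 0 < rho -> 0 <= theta < 1 -> theta ^+ n <= 2^-1 ->
  (forall x y, cabs x = a -> cabs y = b ->
     nroots (line_poly P v w x y) 1 = line_order P v w) ->
  (forall x y, cabs x = a -> cabs y = b -> eval2 P x y != 0) ->
  (forall x y z, cabs x = a -> cabs y = b ->
     theta * rho < cabs z -> theta * cabs z < rho ->
     eval2 P (x * z ^ v) (y * z ^ w) != 0) ->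
  grid_sum P a b n <= grid_sum P (a * rho ^ v) (b * rho ^ w) n +
    n%:R * ((2 * line_order P v w)%:R * ln 4).
Proof.
move=> n0 a0 b0 r0 t01 tn nr nz gap.
pose h : R := 2 * pi / n%:R.
have nR0 : 0 < n%:R :> R by rewrite ltr0n.
have nh : n%:R * h = 2 * pi by rewrite /h mulrC divfK // gt_eqF.
(* All grid points serve as starting points: for fixed [l] the translated grid has the same sum, so
   the triple sum is [n] times the grid sum. *)
have avg a' b' : n%:R * grid_sum P a' b' n = \sum_(j < n) \sum_(k < n) \sum_(l < n)
    ln (cabs (torus_eval P a' b' (j%:R * h + (v * l%:Z)%:~R * h)
                                 (k%:R * h + (w * l%:Z)%:~R * h))).
  under [RHS]eq_bigr => j _ do rewrite exchange_big.
  rewrite exchange_big /=.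
  have -> : n%:R * grid_sum P a' b' n = \sum_(l < n) grid_sum P a' b' n.
    by rewrite sumr_const card_ord mulr_natl.
  rewrite /grid_sum -/h.
  apply: eq_bigr => l _.
  pose g (s : R) := \sum_(k < n)
    ln (cabs (torus_eval P a' b' s (k%:R * h + (w * l%:Z)%:~R * h))).
  have gper s : g (s + n%:R * h) = g s.
    by rewrite nh; apply: eq_bigr => k _; rewrite /torus_eval circle_point_periodic.
  transitivity (\sum_(j < n) g (j%:R * h)); last exact/esym/(sum_shift _ gper).
  apply: eq_bigr => j _.
  pose f (t : R) := ln (cabs (torus_eval P a' b' (j%:R * h) t)).
  have fper t : f (t + n%:R * h) = f t.
    by rewrite nh /f /torus_eval circle_point_periodic.
  exact/esym/(sum_shift (w * l%:Z) fper).
set K := (2 * line_order P v w)%:R * ln 4.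
suff key : n%:R * grid_sum P a b n <=
    n%:R * grid_sum P (a * rho ^ v) (b * rho ^ w) n + n%:R * (n%:R * K).
  by rewrite -(ler_pM2l nR0) (mulrDr _ (grid_sum _ _ _ _)).
have -> : n%:R * (n%:R * K) = \sum_(j < n) \sum_(k < n) K.
  by rewrite !sumr_const !card_ord !mulr_natl.
rewrite [X in X <= _](avg a b).
rewrite [X in _ <= X + _](avg (a * rho ^ v) (b * rho ^ w)).
rewrite -big_split.
apply: ler_sum => j _.
rewrite -big_split.
apply: ler_sum => k _.
exact: (line_sum_le (theta := theta) _ _ n0 erefl).
Qed.

Definition square_mean (S : nat -> R) (m : R) := exists c : R, forall n, (0 < n)%N ->
  `|m - S n / n%:R ^+ 2| <= c / n%:R.

Lemma square_mean_le (S S' : nat -> R) m m' K e n0 :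
  square_mean S m -> square_mean S' m' ->
  (forall n, (n0 <= n)%N -> (0 < n)%N ->
     S n <= S' n + n%:R * K + n%:R ^+ 2 * e) ->
  m <= m' + e.
Proof.
move=> [c mc] [c' mc'] SS'; rewrite leNgt; apply/negP; rewrite -subr_gt0.
set d := m - (m' + e) => d0.
(* So large that [(c + c' + K) / n < d], against the comparison of the means at this [n]. *)
pose n := maxn n0 (Num.bound (`|c + c' + K| / d)).+1.
have n1 : (0 < n)%N by rewrite leq_max orbT.
have nR : 0 < n%:R :> R by rewrite ltr0n.
have nd : `|c + c' + K| < n%:R * d.
  rewrite -ltr_pdivrMr //; apply: lt_le_trans (archi_boundP _) _.
    by rewrite divr_ge0 // ltW.
  by rewrite ler_nat (leq_trans (leqnSn _)) // leq_maxr.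
have /ler_normlP[_ h1] := mc n n1; have /ler_normlP[h2 _] := mc' n n1.
have h3 : S n / n%:R ^+ 2 <= S' n / n%:R ^+ 2 + K / n%:R + e.
  rewrite ler_pdivrMr ?exprn_gt0 // (le_trans (SS' n (leq_maxl _ _) n1)) //.
  rewrite le_eqVlt; apply/orP; left.
  by apply/eqP; field; rewrite gt_eqF.
have : d <= (c + c' + K) / n%:R by rewrite /d !mulrDl; lra.
rewrite ler_pdivlMr // mulrC; have := ler_norm (c + c' + K); lra.
Qed.

(** The lower bound [d] makes [lne] agree with the finite [ln] and the integrand Lipschitz, so
    [riemann2] applies with step [2 pi / n]. *)
Lemma mahler_grid_mean P a b d : 0 < d ->
  (forall s t, d <= cabs (torus_eval P a b s t)) ->
  exists2 m, mahler a b (eval2 P) = m%:E & square_mean (grid_sum P a b) m.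
Proof.
move=> d0 dP; have [L L0 GL] := ln_torus_lip d0 dP.
have pi0 := pi_gt0 R; have w0 : 0 < 2 * pi :> R by rewrite mulr_gt0.
have [V VE VG] := riemann2 (ltW w0) L0 GL (measurable_ln_torus P a b).
exists ((2 * pi) ^- 2 * V).
  rewrite /mahler EFinM -VE; congr (_ * _)%E; apply: eq_integral => p _.
  by rewrite lne_EFin // (lt_le_trans d0) // dP.
exists (2 * L * (2 * pi)) => n n0; have nR : 0 < n%:R :> R by rewrite ltr0n.
have n1 : (n%:R : R) != 0 by rewrite gt_eqF.
have h0 : 0 <= 2 * pi / n%:R :> R by rewrite divr_ge0 // ltW.
have hE : 2 * pi = n%:R * (2 * pi / n%:R) :> R by rewrite [RHS]mulrC divfK.
have le1 := VG n _ h0 hE.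
have e1 (w S : R) : w != 0 ->
    w ^- 2 * V - S / n%:R ^+ 2 = w ^- 2 * (V - (w / n%:R) ^+ 2 * S).
  by move=> wN; field; rewrite n1 wN.
have e2 (w : R) : 2 * w ^+ 2 * L * (w / n%:R) = 2 * L * w / n%:R * w ^+ 2.
  by field.
rewrite e1 ?gt_eqF // normrM ger0_norm ?invr_ge0 ?exprn_ge0 ?(ltW w0) //.
by rewrite mulrC ler_pdivrMr ?exprn_gt0 // (le_trans le1) // e2.
Qed.

End Ronkin.

(** * The inequality between the Mahler measures on two tori *)

Section MeanInequality.
Variable R : realType.
Local Notation C := R[i].
Implicit Types (P Q : laurent2 R) (x y z : C) (a b : R).

Lemma expRXz (u : R) (i : int) : expR u ^ i = expR (i%:~R * u).
Proof.
case: i => n; first by rewrite -exprnP -expRM_natl.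
by rewrite NegzE -exprnN -expRM_natl -expRN mulrNz mulNr.
Qed.

Lemma near_expR_lin (A e : R) (k : int * int) : 0 <= A -> 0 < e ->
  exists2 kappa, 0 < kappa & forall sg tu, `|sg| <= kappa -> `|tu| <= kappa ->
    A * `|expR (k.1%:~R * sg + k.2%:~R * tu) - 1| <= e.
Proof.
move=> A0 e0; have e10 : 0 < e / (A + 1) by rewrite divr_gt0 // ltr_wpDl.
have /cvgrPdist_le/(_ _ e10) := @continuous_expR R 0.
move=> /nbhs_ballP[d /= d0 bd].
pose N : R := `|k.1%:~R| + `|k.2%:~R| + 1.
have N0 : 0 < N by rewrite ltr_wpDl // addr_ge0.
exists (d / 2 / N); first by rewrite !divr_gt0.
move=> sg tu hs ht; set t := _ * sg + _.
have td : `|t| < d.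
  rewrite /t (le_lt_trans (ler_normD _ _)) // !normrM.
  have le1 : `|k.1%:~R| * `|sg| + `|k.2%:~R| * `|tu| <= (N - 1) * (d / 2 / N).
    by rewrite /N addrK mulrDl lerD // ler_wpM2l.
  rewrite (le_lt_trans le1) //.
  have : d / 2 / N * N = d / 2 by rewrite divfK // gt_eqF.
  have : 0 < d / 2 / N by rewrite !divr_gt0.
  nra.
have := bd t; rewrite -ball_normE /= sub0r normrN => /(_ td).
rewrite expR0 distrC => le1.
apply: le_trans (_ : (A + 1) * (e / (A + 1)) <= _); last first.
  by rewrite mulrC divfK // gt_eqF // ltr_wpDl.
by rewrite ler_pM // lerDl.
Qed.

(** Uniform in the angles, because changing the radii multiplies each monomial by a factor that is
    independent of them. *)
Lemma torus_eval_radii P a b e : 0 < a -> 0 < b -> 0 < e ->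
  exists2 kappa, 0 < kappa & forall sg tu, `|sg| <= kappa -> `|tu| <= kappa ->
    forall s t, cabs (torus_eval P (a * expR sg) (b * expR tu) s t
                      - torus_eval P a b s t) <= e.
Proof.
move=> a0 b0 e0.
pose A (k : int * int) := cabs (P k) * (a ^ k.1 * b ^ k.2).
have A0 k : 0 <= A k by rewrite mulr_ge0 ?cabs_ge0 // mulr_ge0 // exprz_ge0 // ltW.
have [kappa k0 hk] : exists2 kappa, 0 < kappa & forall sg tu, `|sg| <= kappa ->
   `|tu| <= kappa -> \sum_(k <- finsupp P)
      A k * `|expR (k.1%:~R * sg + k.2%:~R * tu) - 1| <= e.
  elim: (enum_fset (finsupp P)) e e0 => [|k s ih] e e0.
    by exists 1 => // sg tu _ _; rewrite big_nil ltW.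
  have e20 : 0 < e / 2 by rewrite divr_gt0.
  have [k1 k10 h1] := near_expR_lin k (A0 k) e20; have [k2 k20 h2] := ih _ e20.
  exists (Num.min k1 k2); first by rewrite lt_min k10.
  move=> sg tu; rewrite !le_min => /andP[s1 s2] /andP[t1 t2].
  by rewrite big_cons (splitr e) lerD ?h1 ?h2.
exists kappa => // sg tu hs ht s t; rewrite !torus_evalE -sumrB.
rewrite (le_trans (ler_cabs_sum _ _)) // (le_trans _ (hk sg tu hs ht)) //.
apply: ler_sum => k _; rewrite -mulrBl cabsM cabs_cis mulr1 -mulrBr cabsM /A.
rewrite -mulrA ler_wpM2l ?cabs_ge0 // -rmorphB cabsR.
rewrite !expfzMl !expRXz expRD.
set X := a ^ _; set Y := b ^ _; set U := expR _; set W := expR _.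
have -> : X * U * (Y * W) - X * Y = X * Y * (U * W - 1) by ring.
by rewrite normrM ger0_norm // mulr_ge0 // exprz_ge0 // ltW.
Qed.

(* Taking [rho = exp (- tau)] with [tau] small, the integral powers of [rho] are
   dense enough to carry [(a, b)] into any neighbourhood of [(a', b')]. *)
Lemma expR_floor (c c' tau : R) : 0 < c -> 0 < c' -> 0 < tau ->
  exists (v : int) (sg : R), [/\ 0 <= sg <= tau & c * expR (- tau) ^ v = c' * expR sg].
Proof.
move=> c0 c'0 tau0; pose v := Num.floor ((ln c - ln c') / tau).
exists v, (ln c - ln c' - v%:~R * tau); split.
  have /andP[v1 v2] := floor_itv ((ln c - ln c') / tau).
  rewrite -/v in v1 v2.
  rewrite subr_ge0 -ler_pdivlMr // v1 /= lerBlDr.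
  have := ltW v2; rewrite ler_pdivrMr // intrD mulrDl mul1r addrC; lra.
rewrite expRXz -{1}(lnK c0) -{1}(lnK c'0) -!expRD; congr expR; ring.
Qed.

(** The root count is assumed at [(a, b)] only, which makes [(a, b)] a minimum. The choices are made
    in the order [e], [tau], [v] and [w], [theta], [n]; so [line_order P v w] may grow as [e]
    shrinks, being constant when [n] tends to infinity. *)
Lemma mean_le P a b a' b' d d' m m' :
  0 < a -> 0 < b -> 0 < a' -> 0 < b' -> 0 < d -> 0 < d' ->
  (forall s t, d <= cabs (torus_eval P a b s t)) ->
  (forall s t, d' <= cabs (torus_eval P a' b' s t)) ->
  (forall v w x y, cabs x = a -> cabs y = b ->
     nroots (line_poly P v w x y) 1 = line_order P v w) ->
  square_mean (grid_sum P a b) m -> square_mean (grid_sum P a' b') m' ->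
  m <= m'.
Proof.
move=> a0 b0 a'0 b'0 d0 d'0 hd hd' nr Mm Mm'.
apply/ler_addgt0Pr => e e0.
have onT c c' x y : 0 < c -> 0 < c' -> cabs x = c -> cabs y = c' ->
    exists s t, eval2 P x y = torus_eval P c c' s t.
  move=> c0 c'0 xc yc; have [s _ ->] := polar x; have [t _ ->] := polar y.
  by exists s, t; rewrite xc yc.
(* The first bound keeps [P] away from 0 near the second torus; the second becomes [e] under
   [ln_lip]. *)
pose f := Num.min (d' / 2) (e * (d' / 2)).
have f0 : 0 < f by rewrite lt_min !mulr_gt0 ?divr_gt0.
have [kappa k0 hk] := torus_eval_radii P a'0 b'0 f0.
have half_le (x y : C) : d' <= cabs x -> cabs (y - x) <= d' / 2 -> d' / 2 <= cabs y.
  by rewrite cabsBC; have := ler_cabsB x y; lra.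
have ln_le (x y : C) : d' / 2 <= cabs x -> d' <= cabs y -> cabs (x - y) <= f ->
    ln (cabs x) <= ln (cabs y) + e.
  move=> hx hy xy; have d20 : 0 < d' / 2 by rewrite divr_gt0.
  have hy' : d' / 2 <= cabs y by lra.
  rewrite -lerBlDl (le_trans (ler_norm _)) // (le_trans (ln_lip d20 hx hy')) //.
  rewrite ler_pdivrMr // (le_trans (ler_dist_cabs _ _)) // (le_trans xy) //.
  by rewrite ge_min lexx orbT.
have near_d sg tu : `|sg| <= kappa -> `|tu| <= kappa -> forall s t,
    d' / 2 <= cabs (torus_eval P (a' * expR sg) (b' * expR tu) s t).
  move=> hs ht s t; have := hk sg tu hs ht s t; rewrite le_min => /andP[h1 _].
  exact: half_le (hd' s t) h1.
(* Half of [kappa] pays for rounding [v] and [w] to integers, the other half for the width of the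
   annulus. *)
pose tau := kappa / 2; have tau0 : 0 < tau by rewrite divr_gt0.
have kE : kappa = tau + tau by rewrite /tau -splitr.
have [v [sg [/andP[sg0 sg1] av]]] := expR_floor a0 a'0 tau0.
have [w [tu [/andP[tu0 tu1] bw]]] := expR_floor b0 b'0 tau0.
set rho := expR (- tau) in av bw; have rho0 : 0 < rho by exact: expR_gt0.
(* If [|z| = rho * expR xi] with [|xi| <= eta], the logarithmic radii move by [v xi] and [w xi],
   hence by at most [tau]. *)
pose eta := tau / (`|v%:~R| + `|w%:~R| + 1) : R.
have N0 : 0 < `|v%:~R| + `|w%:~R| + 1 :> R by rewrite ltr_wpDl // addr_ge0.
have eta0 : 0 < eta by rewrite divr_gt0.
have etaE : eta * (`|v%:~R| + `|w%:~R| + 1) = tau by rewrite /eta divfK // gt_eqF.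
pose theta := expR (- eta).
have th01 : 0 <= theta < 1 by rewrite expR_ge0 /= expR_lt1 oppr_lt0.
have gap x y z : cabs x = a -> cabs y = b ->
    theta * rho < cabs z -> theta * cabs z < rho -> eval2 P (x * z ^ v) (y * z ^ w) != 0.
  move=> xa yb z1 z2; have z0 : 0 < cabs z.
    by rewrite (le_lt_trans _ z1) // mulr_ge0 ?expR_ge0.
  pose xi := ln (cabs z) + tau.
  have zE : cabs z = rho * expR xi by rewrite /rho -expRD /xi addrCA addNr addr0 lnK.
  have [xi1 xi2] : - eta <= xi /\ xi <= eta.
    split.
      move: z1; rewrite zE mulrC ltr_pM2l // ltr_expR; exact: ltW.
    move: z2; rewrite zE mulrCA -[X in _ < X]mulr1 ltr_pM2l // -expRD -expR0 ltr_expR.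
    by rewrite addrC subr_lt0 => /ltW.
  have small (i : int) r : 0 <= r -> r <= tau ->
      `|i%:~R : R| <= `|v%:~R| + `|w%:~R| + 1 -> `|r + i%:~R * xi| <= kappa.
    move=> r0 r1 iN; rewrite kE (le_trans (ler_normD _ _)) // lerD //; first by rewrite ger0_norm.
    rewrite normrM -etaE mulrC ler_pM // ler_norml.
    by rewrite xi1 xi2.
  have xz : cabs (x * z ^ v) = a' * expR (sg + v%:~R * xi).
    by rewrite cabsM cabsXz xa zE expfzMl mulrA av -mulrA expRXz expRD.
  have yz : cabs (y * z ^ w) = b' * expR (tu + w%:~R * xi).
    by rewrite cabsM cabsXz yb zE expfzMl mulrA bw -mulrA expRXz expRD.
  have [s [t ->]] := onT _ _ _ _ (mulr_gt0 a'0 (expR_gt0 _)) (mulr_gt0 b'0 (expR_gt0 _)) xz yz.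
  rewrite -cabs_gt0 (lt_le_trans (_ : 0 < d' / 2)) ?divr_gt0 // near_d //.
    by rewrite small // -addrA lerDl addr_ge0.
  by rewrite small // addrAC lerDr addr_ge0.
have nz x y : cabs x = a -> cabs y = b -> eval2 P x y != 0.
  move=> xa yb; have [s [t ->]] := onT _ _ _ _ a0 b0 xa yb.
  by rewrite -cabs_gt0 (lt_le_trans d0).
have sgk : `|sg| <= kappa by rewrite ger0_norm // kE; lra.
have tuk : `|tu| <= kappa by rewrite ger0_norm // kE; lra.
have th2 : \forall n \near \oo, theta ^+ n <= 2^-1 by apply: near_expr_le; rewrite ?invr_gt0.
have [n0 _ hn0] := th2.
apply: (square_mean_le (n0 := n0) (K := (2 * line_order P v w)%:R * ln 4) Mm Mm').
move=> n nn0 n1.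
have := grid_sum_le n1 a0 b0 rho0 th01 (hn0 n nn0) (nr v w) nz gap.
(* The curve ends at the radii [a' * expR sg] and [b' * expR tu]; passing to [a'] and [b'] costs at
   most [e] at each of the [n^2] grid points. *)
rewrite av bw => /le_trans; apply; rewrite addrAC lerD2r.
have -> : n%:R ^+ 2 * e = \sum_(j < n) \sum_(k < n) e.
  by rewrite !sumr_const !card_ord -[RHS]mulr_natl -[e *+ n]mulr_natl mulrA.
rewrite /grid_sum -big_split; apply: ler_sum => j _.
rewrite -big_split; apply: ler_sum => k _ /=.
apply: ln_le; [exact: near_d|exact: hd'|exact: hk].
Qed.

End MeanInequality.

(** * Application to [Q_r] for [r] in the unbounded components *)

Section Ronkin_minimum.
Variable R : realType.
Local Notation C := R[i].
Implicit Types (P Q : laurent2 R) (x y z r : C) (a b : R).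

(** A point of [K] has an empty component in the complement, and the empty set is bounded. *)
Lemma unbounded_componentN (K : set C^o) r : unbounded_component K r -> ~ K r.
Proof.
move=> ub Kr; apply: ub; rewrite connected_component_out; last by move=> /(_ Kr).
by exists 0; split=> // M _ z [].
Qed.

Lemma torus_component_separated Q a b r : 0 < a -> 0 < b ->
  unbounded_component (torus_image Q a b) r ->
  exists2 d, 0 < d & forall x y, cabs x = a -> cabs y = b ->
    d <= cabs (eval2 (const_sub r Q) x y).
Proof.
move=> a0 b0 /unbounded_componentN/(torus_image_separated a0 b0)[d d0 hd].
exists d => // x y xa yb; rewrite eval2_const_sub; apply: hd.
by apply/torus_imageP; exists x, y.
Qed.

(** [X] and [Y] stand for any curve on the torus: the coordinate circles behind [nu1] and [nu2], or
    the curves behind [line_poly]. *)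
Lemma nroots_torus Q a b r (p : {poly C}) (M : nat) c (X Y : C -> C) :
  0 < a -> 0 < b -> 0 < c -> unbounded_component (torus_image Q a b) r ->
  (forall u, cabs u = c -> [/\ cabs (X u) = a, cabs (Y u) = b &
     p.[u] = u ^+ M * eval2 (const_sub r Q) (X u) (Y u)]) ->
  nroots p c = M.
Proof.
move=> a0 b0 c0 ub hp; apply: (nroots_unbounded (r := r) c0) ub.
  by move=> s; exact: torus_image_separated.
move=> u uc; have [Xu Yu ->] := hp u uc.
have u0 : u != 0 by rewrite -cabs_gt0 uc.
rewrite mulrAC divff ?expf_neq0 // mul1r eval2_const_sub opprB addrC subrK.
by apply/torus_imageP; exists (X u), (Y u).
Qed.

Lemma nroots_line_poly Q a b r v w x y : 0 < a -> 0 < b ->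
  unbounded_component (torus_image Q a b) r -> cabs x = a -> cabs y = b ->
  nroots (line_poly (const_sub r Q) v w x y) 1 = line_order (const_sub r Q) v w.
Proof.
move=> a0 b0 ub xa yb.
apply: (nroots_torus (X := fun u => x * u ^ v) (Y := fun u => y * u ^ w) a0 b0 ltr01 ub).
move=> u u1; have u0 : u != 0 by rewrite -cabs_gt0 u1.
by rewrite !cabsM !cabsXz u1 !exp1rz !mulr1 horner_line_poly.
Qed.

Lemma nu_torus_eq0 Q a b r (f : laurent1 R) c (X Y : C -> C) :
  0 < a -> 0 < b -> 0 < c -> unbounded_component (torus_image Q a b) r ->
  (forall u, cabs u = c -> [/\ cabs (X u) = a, cabs (Y u) = b &
     eval1 f u = eval2 (const_sub r Q) (X u) (Y u)]) ->
  nu f c = 0.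
Proof.
move=> a0 b0 c0 ub hf.
have hp u : cabs u = c -> [/\ cabs (X u) = a, cabs (Y u) = b &
    (clear_pole f).[u] = u ^+ pole_order f * eval2 (const_sub r Q) (X u) (Y u)].
  move=> uc; have [Xu Yu fu] := hf u uc; split=> //.
  by rewrite horner_clear_pole ?fu // -cabs_gt0 uc.
apply: nu_eq0 => //; last exact: nroots_torus ub hp.
have cc : cabs c%:C = c by rewrite cabsR gtr0_norm.
have [Xc Yc pc] := hp _ cc; have [d d0 hd] := torus_component_separated a0 b0 ub.
suff : (clear_pole f).[c%:C] != 0 by apply: contraNneq => ->; rewrite horner0.
rewrite pc mulf_neq0 ?expf_neq0 // -cabs_gt0 ?cc //.
exact: lt_le_trans d0 (hd _ _ Xc Yc).
Qed.

Lemma nu1_eq0 Q a b r : 0 < a -> 0 < b ->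
  unbounded_component (torus_image Q a b) r -> nu1 Q a b r = 0.
Proof.
move=> a0 b0 ub.
apply: (nu_torus_eq0 (X := id) (Y := fun=> b%:C) a0 b0 a0 ub) => u ua.
by rewrite cabsR gtr0_norm // eval1_slice1.
Qed.

Lemma nu2_eq0 Q a b r : 0 < a -> 0 < b ->
  unbounded_component (torus_image Q a b) r -> nu2 Q a b r = 0.
Proof.
move=> a0 b0 ub.
apply: (nu_torus_eq0 (X := fun=> a%:C) (Y := id) a0 b0 b0 ub) => u ub'.
by rewrite cabsR gtr0_norm // eval1_slice2.
Qed.

Lemma mahler_torus_eq Q a b a' b' r : 0 < a -> 0 < b -> 0 < a' -> 0 < b' ->
  unbounded_component (torus_image Q a b) r ->
  unbounded_component (torus_image Q a' b') r ->
  mahler a b (eval2 (const_sub r Q)) = mahler a' b' (eval2 (const_sub r Q)).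
Proof.
move=> a0 b0 a'0 b'0 ub ub'.
have [d d0 hd] := torus_component_separated a0 b0 ub.
have [d' d'0 hd'] := torus_component_separated a'0 b'0 ub'.
have {}hd s t : d <= cabs (torus_eval (const_sub r Q) a b s t).
  by apply: hd; exact: circle_cabs.
have {}hd' s t : d' <= cabs (torus_eval (const_sub r Q) a' b' s t).
  by apply: hd'; exact: circle_cabs.
have [m -> mm] := mahler_grid_mean d0 hd.
have [m' -> mm'] := mahler_grid_mean d'0 hd'.
congr EFin; apply/eqP; rewrite eq_le; apply/andP; split.
  apply: (mean_le a0 b0 a'0 b'0 d0 d'0 hd hd' _ mm mm') => v w x y.
  exact: nroots_line_poly.
apply: (mean_le a'0 b'0 a0 b0 d'0 d0 hd' hd _ mm' mm) => v w x y.
exact: nroots_line_poly.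
Qed.

End Ronkin_minimum.

Theorem theorem1p2 (R : realType) (Q : laurent2 R) (a b : R)
    (hQ : Q (0, 0) = 0) (ha : 0 < a) (hb : 0 < b) :
  let U := unbounded_component (torus_image Q a b)
             `&` unbounded_component (torus_image Q 1 1) in
  (forall r : R[i], U r ->
     mahler a b (eval2 (const_sub r Q)) =
       (mahler 1 1 (eval2 (const_sub r Q)) +
        ((nu1 Q a b r)%:~R * ln a + (nu2 Q a b r)%:~R * ln b)%:E)%E) /\
  (forall r r' : R[i], U r -> U r' ->
     nu1 Q a b r = nu1 Q a b r' /\ nu2 Q a b r = nu2 Q a b r').
Proof.
move=> U; split=> [r [ub ub1]|r r' [ub _] [ub' _]].
  rewrite nu1_eq0 // nu2_eq0 // !mul0r addr0 adde0.
  exact: mahler_torus_eq.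
by rewrite !nu1_eq0 // !nu2_eq0.
Qed.
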